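(* Let $n>2$ be an integer with $n\not\equiv 2 \bmod 4$, let $K=\mathbb{Q}(\xi_n)$ be the $n$-th cyclotomic field, with ring of integers $\mathcal{O}_n=\mathbb{Z}[\xi_n]$, let $k\geqslant 2$ be an integer, and let $V_k$ be the set of all $k$-free elements of $\mathcal{O}_n$. If $A\colon \mathcal{O}_n\to\mathcal{O}_n$ is a $\mathbb{Z}$-linear bijection with $A(V_k)\subseteq V_k$, then there exist a unit $\varepsilon\in\mathcal{O}_n^{\times}$ and a Galois automorphism $\sigma\in\mathrm{Gal}(K/\mathbb{Q})$ such that $A=M_{\varepsilon}\circ\sigma$. Thus, the stabiliser of the set $V_k$ is the group \[ \mathrm{stab}(V_k)\,=\,\mathcal{O}_n^{\times}\rtimes \mathrm{Gal}(K/\mathbb{Q})\,=\,\mathcal{O}_n^{\times}\rtimes \mathrm{Aut}_{\mathbb{Q}}\bigl(\mathbb{Q}(\xi_n)\bigr). \]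
   Context: $\xi_n$ denotes a primitive $n$-th root of unity. A non-zero element $x\in\mathcal{O}_n$ is called $k$-free if the principal ideal $(x)=x\mathcal{O}_n$ is not divisible by the $k$-th power of any (non-zero) prime ideal of $\mathcal{O}_n$; $0$ is not $k$-free. The stabiliser $\mathrm{stab}(V_k)$ is the monoid (under composition) of all $\mathbb{Z}$-linear bijections $A\colon\mathcal{O}_n\to\mathcal{O}_n$ with $A(V_k)\subseteq V_k$. For a unit $\varepsilon\in\mathcal{O}_n^{\times}$, $M_\varepsilon$ denotes the map $x\mapsto\varepsilon x$ on $\mathcal{O}_n$; a Galois automorphism $\sigma$ acts on $\mathcal{O}_n$ by restriction. In the semidirect product, $\mathcal{O}_n^{\times}$ is identified with $\{M_\varepsilon:\varepsilon\in\mathcal{O}_n^\times\}$ and $\mathrm{Gal}(K/\mathbb{Q})$ acts by $\sigma\circ M_\varepsilon\circ\sigma^{-1}=M_{\sigma(\varepsilon)}$. Recall that $\mathrm{Gal}(K/\mathbb{Q})=\mathrm{Aut}_{\mathbb{Q}}(K)\simeq(\mathbb{Z}/n\mathbb{Z})^{\times}$, with $r \bmod n$ corresponding to the automorphism $\xi_n\mapsto\xi_n^r$, and that $\mathcal{O}_n^\times$ is the unit group of $\mathcal{O}_n$. *)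

(* Defs.v *)
From HB Require Import structures.
From mathcomp Require Import all_boot all_order all_algebra all_fingroup all_field.
From mathcomp Require Import boolp classical_sets.

Set Implicit Arguments.
Unset Strict Implicit.
Unset Printing Implicit Defensive.

Import GRing.Theory.

Local Open Scope classical_set_scope.
Local Open Scope ring_scope.

(* The ring of integers of K: the integral closure of Z in K, as a subring. *)

Definition integralb (K : fieldType) : {pred K} :=
  fun x => `[< integralOver (intr : int -> K) x >].

Lemma integralb_subring (K : fieldType) : subring_closed (@integralb K).
Proof.
split=> [|x y /asboolP xI /asboolP yI|x y /asboolP xI /asboolP yI].
- by apply/asboolP; apply: integral1.
- by apply/asboolP; apply: integral_sub.
- by apply/asboolP; apply: integral_mul.
Qed.

HB.instance Definition _ (K : fieldType) :=
  GRing.isSubringClosed.Build K (@integralb K) (@integralb_subring K).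

Record ringInt (K : fieldType) :=
  RingInt { ringInt_val : K; ringInt_valP : ringInt_val \in @integralb K }.

HB.instance Definition _ (K : fieldType) := [isSub for @ringInt_val K].
HB.instance Definition _ (K : fieldType) := [Choice of ringInt K by <:].
HB.instance Definition _ (K : fieldType) :=
  [SubChoice_isSubComNzRing of ringInt K by <:].

Section RingIntUnits.
Variable K : fieldType.

Definition ringInt_unit : {pred ringInt K} :=
  fun x => `[< exists y : ringInt K, y * x = 1 >].

Definition ringInt_inv (x : ringInt K) : ringInt K :=
  if pselect (exists y : ringInt K, y * x = 1) is left xU
  then sval (cid xU) else x.

Lemma ringInt_mulVx : {in ringInt_unit, left_inverse 1 ringInt_inv *%R}.
Proof.
move=> x /asboolP xU; rewrite /ringInt_inv; case: pselect => xU'; last by [].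
exact: svalP (cid xU').
Qed.

Lemma ringInt_unitPl (x y : ringInt K) : y * x = 1 -> ringInt_unit x.
Proof. by move=> yx1; apply/asboolP; exists y. Qed.

Lemma ringInt_inv_out : {in [predC ringInt_unit], ringInt_inv =1 id}.
Proof.
move=> x /asboolP xNU; rewrite /ringInt_inv; case: pselect => // xU.
Qed.

HB.instance Definition _ := GRing.ComNzRing_hasMulInverse.Build (ringInt K)
  ringInt_mulVx ringInt_unitPl ringInt_inv_out.

End RingIntUnits.

(* Ideals of a commutative ring, possibly equal to the whole ring. *)

Section Ideals.
Variable R : comNzRingType.
Implicit Types (I J P : set R) (x : R).

Definition is_ideal I :=
  I 0 /\ forall a x y, I x -> I y -> I (a * x + y).

Definition principal_ideal x : set R := [set a * x | a in setT].

Definition idealM I J : set R :=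
  [set x | exists2 s : seq (R * R),
     (forall p, p \in s -> I p.1 /\ J p.2) & x = \sum_(p <- s) p.1 * p.2].

Definition idealX I (k : nat) : set R := iter k (idealM I) setT.

Definition ideal_dvd I J := exists2 C : set R, is_ideal C & J = idealM I C.

Definition is_prime_ideal P :=
  [/\ is_ideal P, ~ P 1 & forall x y, P (x * y) -> P x \/ P y].

Definition kfree (k : nat) : set R :=
  [set x | x <> 0 /\
    forall P, is_prime_ideal P -> P <> [set 0] ->
      ~ ideal_dvd (idealX P k) (principal_ideal x)].

End Ideals.

(* For an additive group, Z-linear maps are the additive ones. *)
Definition Zlinear_bij (M : zmodType) : set (M -> M) :=
  [set A : M -> M | {morph A : x y / x + y} /\ bijective A].

Definition stab (M : zmodType) (V : set M) : set (M -> M) :=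
  [set A : M -> M | Zlinear_bij A /\ A @` V `<=` V].

Record unitGroup (R : comUnitRingType) :=
  UnitGroup { unit_val : R; unit_valP : unit_val \is a GRing.unit }.

Section UnitGroup.
Variable R : comUnitRingType.
Implicit Types u v w : unitGroup R.

HB.instance Definition _ := [isSub for @unit_val R].
HB.instance Definition _ := [Choice of unitGroup R by <:].

Lemma unitGroup1_subproof : (1 : R) \is a GRing.unit.
Proof. exact: unitr1. Qed.
Lemma unitGroupV_subproof u : (val u)^-1 \is a GRing.unit.
Proof. by rewrite unitrV; apply: valP. Qed.
Lemma unitGroupM_subproof u v : val u * val v \is a GRing.unit.
Proof. by rewrite unitrM !unit_valP. Qed.

Definition unitGroup1 := UnitGroup unitGroup1_subproof.
Definition unitGroupV u := UnitGroup (unitGroupV_subproof u).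
Definition unitGroupM u v := UnitGroup (unitGroupM_subproof u v).

Lemma unitGroupMA : associative unitGroupM.
Proof. by move=> u v w; apply/val_inj/mulrA. Qed.
Lemma unitGroup1M : left_id unitGroup1 unitGroupM.
Proof. by move=> u; apply/val_inj/mul1r. Qed.
Lemma unitGroupM1 : right_id unitGroup1 unitGroupM.
Proof. by move=> u; apply/val_inj/mulr1. Qed.
Lemma unitGroupVM : left_inverse unitGroup1 unitGroupV unitGroupM.
Proof. by move=> u; apply/val_inj/mulVr/valP. Qed.
Lemma unitGroupMV : right_inverse unitGroup1 unitGroupV unitGroupM.
Proof. by move=> u; apply/val_inj/mulrV/valP. Qed.

HB.instance Definition _ := isGroup.Build (unitGroup R)
  unitGroupMA unitGroup1M unitGroupM1 unitGroupVM unitGroupMV.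

End UnitGroup.

Definition mulBy (R : comUnitRingType) (u : unitGroup R) : R -> R :=
  fun x => val u * x.

(* The Q-algebra automorphisms of K, as functions. *)
Definition AutQ (K : fieldExtType rat) : set (K -> K) :=
  [set f : K -> K | [/\ bijective f, f 1 = 1, {morph f : x y / x + y},
               {morph f : x y / x * y}
             & forall (a : rat) (x : K), f (a *: x) = a *: f x]].
Arguments AutQ : clear implicits.

(* gal_of {:K} is the type of Galois automorphisms of K over its base field   *)
(* Q: all its elements lie in 'Gal({:K} / 1).                                 *)
Section Gal.
Variable K : splittingFieldType rat.
Implicit Types (s t : gal_of {:K}) (x : ringInt K) (u : unitGroup (ringInt K)).

Lemma gal_of_mem s : s \in 'Gal({:K} / 1)%g.
Proof.
by rewrite gal_kAut ?sub1v // kAut1E limg_gal.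
Qed.

Lemma galO_subproof s x : s (val x) \in @integralb K.
Proof.
have /asboolP[p p_mon px0] := valP x; apply/asboolP; exists p => //.
have -> : map_poly intr p = map_poly s (map_poly intr p).
  rewrite -map_poly_comp; apply: eq_map_poly => a /=.
  by rewrite rmorph_int.
by rewrite fmorph_root.
Qed.

(* The restriction of s to the ring of integers. *)
Definition galO s (x : ringInt K) : ringInt K := RingInt (galO_subproof s x).

Lemma galO_val s x : val (galO s x) = s (val x). Proof. by []. Qed.

Lemma galOM s x y : galO s (x * y) = galO s x * galO s y.
Proof. by apply: val_inj; rewrite /= rmorphM. Qed.

Lemma galO1 s : galO s 1 = 1.
Proof. by apply: val_inj; rewrite /= rmorph1. Qed.

Lemma galO_id x : galO 1%g x = x.
Proof. by apply: val_inj; rewrite /= gal_id. Qed.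

(* In gal_of, s * t is s followed by t. *)
Lemma galO_comp s t x : galO (s * t)%g x = galO t (galO s x).
Proof. by apply: val_inj; rewrite /= galM ?memvf. Qed.

Lemma galU_subproof s u : galO s (val u) \is a GRing.unit.
Proof.
apply/unitrP; exists (galO s (val u)^-1).
by rewrite -!galOM mulVr ?mulrV ?galO1 //; apply: valP.
Qed.

Definition galU s u : unitGroup (ringInt K) := UnitGroup (galU_subproof s u).

Lemma galO_mulBy s u : galO s \o mulBy u \o galO s^-1%g = mulBy (galU s u).
Proof.
apply/funext => x; rewrite /= /mulBy galOM -galO_comp mulVg galO_id.
by [].
Qed.

Lemma galUM s u v : galU s (u * v)%g = (galU s u * galU s v)%g.
Proof. by apply: val_inj; apply: galOM. Qed.
Lemma galU1 s : galU s 1%g = 1%g.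
Proof. by apply: val_inj; apply: galO1. Qed.
Lemma galU_id u : galU 1%g u = u.
Proof. by apply: val_inj; apply: galO_id. Qed.
Lemma galU_comp s t u : galU (s * t)%g u = galU t (galU s u).
Proof. by apply: val_inj; apply: galO_comp. Qed.

End Gal.

(* The semidirect product of the units of the ring of integers by the Galois  *)
(* group. As products in gal_of are in diagrammatic order, the composite      *)
(* automorphism written s o t in                                              *)
(*   (M_u o s) o (M_v o t) = M_(u s(v)) o (s o t)                             *)
(* is (t * s)%g.                                                              *)
Record unitGal (K : splittingFieldType rat) :=
  UnitGal { ug_unit : unitGroup (ringInt K); ug_gal : gal_of {:K} }.

Section UnitGal.
Variable K : splittingFieldType rat.
Implicit Types g h : unitGal K.

Definition unitGal_pair g := (ug_unit g, ug_gal g).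
Definition pair_unitGal p : unitGal K := UnitGal p.1 p.2.
Lemma unitGal_pairK : cancel unitGal_pair pair_unitGal.
Proof. by case. Qed.
HB.instance Definition _ := Choice.copy (unitGal K) (can_type unitGal_pairK).

Definition unitGal1 : unitGal K := UnitGal 1%g 1%g.
Definition unitGalM g h : unitGal K :=
  UnitGal (ug_unit g * galU (ug_gal g) (ug_unit h))%g (ug_gal h * ug_gal g)%g.
Definition unitGalV g : unitGal K :=
  UnitGal (galU (ug_gal g)^-1 (ug_unit g)^-1)%g (ug_gal g)^-1%g.

Lemma unitGalMA : associative unitGalM.
Proof.
by move=> [u s] [v t] [w r]; rewrite /unitGalM /= galUM galU_comp !mulgA.
Qed.
Lemma unitGal1M : left_id unitGal1 unitGalM.
Proof. by move=> [u s]; rewrite /unitGalM /= galU_id mul1g mulg1. Qed.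
Lemma unitGalM1 : right_id unitGal1 unitGalM.
Proof. by move=> [u s]; rewrite /unitGalM /= galU1 mul1g mulg1. Qed.
Lemma unitGalVM : left_inverse unitGal1 unitGalV unitGalM.
Proof. by move=> [u s]; rewrite /unitGalM /= -galUM mulVg galU1 mulgV. Qed.
Lemma unitGalMV : right_inverse unitGal1 unitGalV unitGalM.
Proof.
by move=> [u s]; rewrite /unitGalM /= -galU_comp mulVg galU_id mulgV.
Qed.

HB.instance Definition _ := isGroup.Build (unitGal K)
  unitGalMA unitGal1M unitGalM1 unitGalVM unitGalMV.

(* (u, s) acts on the ring of integers as M_u o s. *)
Definition unitGal_fun g : ringInt K -> ringInt K :=
  mulBy (ug_unit g) \o galO (ug_gal g).

End UnitGal.

(* Main.v *)
Require Import Defs.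
From HB Require Import structures.
From mathcomp Require Import all_boot all_order all_algebra all_fingroup all_field.
From mathcomp Require Import boolp classical_sets.
From mathcomp Require Import ring lra zify.

Set Implicit Arguments.
Unset Strict Implicit.
Unset Printing Implicit Defensive.

Import GRing.Theory.
Import Order.TTheory Num.Theory.

Local Open Scope classical_set_scope.
Local Open Scope ring_scope.

(* The argument works in any Galois number field generated by an integral unit
   alpha.

   For infinitely many primes p, split completely in K, O / p^k is a product of
   copies of Z / p^k permuted by the Galois group, with idempotents s(e). An
   element whose coordinate at some s(e) vanishes mod p^k is not k-free, and a
   sieve shows that a class none of whose coordinates vanishes mod p contains a
   k-free element. Hence the linear form (e-coordinate) o A on (Z / p^k)^d has no
   zero with all coordinates prime to p, so mod p only one of its coefficients is
   nonzero; that is, for some s in the Galois group, A x - A 1 * s x is killed by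
   e mod p for all x, and p divides its norm. Some s occurs for infinitely many
   p, and then A x = A 1 * s x for all x.

   The sieve: in a class mod M of Z[alpha] (M taking care of the small primes),
   the elements of a box of side Y lying in Q^k, for a prime Q over l, are
   separated by about l^(k/d), because the difference of two of them has norm
   divisible by l^k; so at most O(Y^d / l^2 + 1) of them occur. *)


(** * Galois action on the ring of integers *)

Section RingIntGal.
Variable K : splittingFieldType rat.
Implicit Types (s t : gal_of {:K}) (x y : ringInt K).

Lemma galO_is_zmod_morphism s : zmod_morphism (@galO K s).
Proof. by move=> x y; apply: val_inj; rewrite /= rmorphB. Qed.
Lemma galO_is_monoid_morphism s : monoid_morphism (@galO K s).
Proof. by split=> [|x y]; [apply: galO1 | apply: galOM]. Qed.
HB.instance Definition _ s :=
  GRing.isZmodMorphism.Build _ _ (@galO K s) (galO_is_zmod_morphism s).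
HB.instance Definition _ s :=
  GRing.isMonoidMorphism.Build _ _ (@galO K s) (galO_is_monoid_morphism s).

Lemma galOK s : cancel (galO s) (galO s^-1%g).
Proof. by move=> x; rewrite -galO_comp mulgV galO_id. Qed.
Lemma galOKV s : cancel (galO s^-1%g) (galO s).
Proof. by move=> x; rewrite -galO_comp mulVg galO_id. Qed.

Lemma galois_base : galois 1 {:K}.
Proof.
rewrite /galois sub1v normalFieldf andbT; apply/separableP => y _.
by apply: pcharf0_separable => p; rewrite pchar_lalg pchar_num.
Qed.

Lemma intr_ringInt_inj : injective (fun a : int => a%:~R : ringInt K).
Proof.
move=> a b /(congr1 val); rewrite !rmorph_int => ab.
have: in_alg K a%:~R = in_alg K b%:~R by rewrite !rmorph_int.
by move/fmorph_inj/eqP; rewrite eqr_int => /eqP.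
Qed.

Lemma ringInt_mul_eq0 x y : x * y = 0 -> x = 0 \/ y = 0.
Proof.
move=> /(congr1 val)/eqP; rewrite rmorphM rmorph0 mulf_eq0.
by case/orP=> /eqP E; [left|right]; apply: val_inj; rewrite E rmorph0.
Qed.

Lemma ringInt_mulIf x y z : x != 0 -> x * y = x * z -> y = z.
Proof.
move=> x0 /eqP; rewrite -subr_eq0 -mulrBr => /eqP/ringInt_mul_eq0[|/eqP].
  by move=> xe; rewrite xe eqxx in x0.
by rewrite subr_eq0 => /eqP.
Qed.

(** Z is integrally closed: the monic equation is carried over to [algC], where a rational algebraic
    integer is an integer. *)
Lemma integral_rat (q : rat) : integralOver (intr : int -> K) q%:A ->
  exists a : int, q = a%:~R.
Proof.
move=> [p p_mon]; rewrite -[map_poly _ p](_ : map_poly (in_alg K) (map_poly intr p) = _).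
  rewrite fmorph_root => pq.
  have : (ratr q : algC) \in Num.int.
    apply: Cint_rat_Aint; first by rewrite Crat_rat.
    apply: (@root_monic_Aint (map_poly intr p)).
    - rewrite -[map_poly _ p](_ : map_poly ratr (map_poly intr p) = _) ?fmorph_root //.
      by rewrite -map_poly_comp; apply: eq_map_poly => a /=; rewrite ratr_int.
    - by apply: monic_map.
    - by apply/polyOverP => i; rewrite coef_map /= intr_int.
  case/intrP => a; rewrite -(ratr_int _ a) => /fmorph_inj ->; by exists a.
by rewrite -map_poly_comp; apply: eq_map_poly => a; apply: (rmorph_int (in_alg K)).
Qed.

Lemma galO_fixed x : (forall s, galO s x = x) -> exists a : int, x = a%:~R.
Proof.
move=> xF.
have : val x \in 1%VS.
  have /galois_fixedField <- := galois_base.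
  apply/fixedFieldP; rewrite ?memvf // => s _.
  by rewrite -galO_val xF.
case/vlineP => q xq.
have /asboolP := valP x; rewrite xq => /integral_rat[a qa].
exists a; apply: val_inj; rewrite xq qa [RHS]rmorph_int.
exact: (rmorph_int (in_alg K)).
Qed.

End RingIntGal.

(** * Ideals, norms and the dual basis *)

Section Divides.
Variable R : comNzRingType.
Implicit Types a b x y : R.

Definition divides a x := exists y, x = a * y.

Lemma divides0 a : divides a 0.
Proof. by exists 0; rewrite mulr0. Qed.
Lemma dividesMr a y : divides a (a * y).
Proof. by exists y. Qed.
Lemma dividesD a x y : divides a x -> divides a y -> divides a (x + y).
Proof. by move=> [u ->] [v ->]; exists (u + v); rewrite mulrDr. Qed.
Lemma dividesN a x : divides a x -> divides a (- x).
Proof. by move=> [u ->]; exists (- u); rewrite mulrN. Qed.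
Lemma dividesB a x y : divides a x -> divides a y -> divides a (x - y).
Proof. by move=> ax ay; apply/dividesD/dividesN. Qed.
Lemma dividesMl a x y : divides a x -> divides a (y * x).
Proof. by move=> [u ->]; exists (y * u); rewrite mulrCA. Qed.
Lemma divides_mulr a x y : divides a x -> divides a (x * y).
Proof. by rewrite mulrC; apply: dividesMl. Qed.
Lemma dividesMM a b x y : divides a x -> divides b y -> divides (a * b) (x * y).
Proof. by move=> [u ->] [v ->]; exists (u * v); rewrite mulrACA. Qed.
Lemma divides_trans a b x : divides a b -> divides b x -> divides a x.
Proof. by move=> [u ->] [v ->]; exists (u * v); rewrite mulrA. Qed.
Lemma divides_sum a (I : Type) (r : seq I) (P : pred I) (F : I -> R) :
  (forall i, P i -> divides a (F i)) -> divides a (\sum_(i <- r | P i) F i).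
Proof.
by move=> aF; elim/big_ind: _ => //; [apply: divides0 | apply: dividesD].
Qed.
Lemma dividesX a x n : divides a x -> divides (a ^+ n) (x ^+ n).
Proof. by move=> [u ->]; exists (u ^+ n); rewrite exprMn. Qed.

Lemma dividesB_sym a x y : divides a (x - y) -> divides a (y - x).
Proof. by move/dividesN; rewrite opprB. Qed.
Lemma divides_congr a x y : divides a (x - y) -> divides a y -> divides a x.
Proof. by move=> /dividesD/[apply]; rewrite subrK. Qed.

Lemma divides_coprime (l : nat) (m : int) x :
  coprimez l m -> divides l%:R (m%:~R * x) -> divides l%:R x.
Proof.
case/coprimezP => -[u v] /= uv lmx.
have -> : x = l%:R * (u%:~R * x) + v%:~R * (m%:~R * x).
  have /esym : u%:~R * l%:R + v%:~R * m%:~R = 1 :> R.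
    by rewrite pmulrn -!intrM -intrD uv.
  by move=> /(congr1 ( *%R^~ x)); rewrite mul1r => {1}->; ring.
by apply: dividesD; [apply: dividesMr | apply: dividesMl].
Qed.

Lemma divides_nat (l m : nat) : (l %| m)%N -> divides l%:R (m%:R : R).
Proof. by case/dvdnP => q ->; exists q%:R; rewrite natrM mulrC. Qed.
Lemma divides_intr (l : nat) (m : int) : (l %| m)%Z -> divides l%:R (m%:~R : R).
Proof. by case/dvdzP => q ->; exists q%:~R; rewrite intrM mulrC. Qed.

End Divides.

Section Ideal.
Variables (R : comNzRingType) (I : set R).
Hypothesis I_ideal : is_ideal I.

Lemma ideal0 : I 0. Proof. by case: I_ideal. Qed.
Lemma idealMl a x : I x -> I (a * x).
Proof. by move=> Ix; rewrite -[_ * _]addr0; apply: I_ideal.2 => //; apply: ideal0. Qed.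
Lemma ideal_mulr a x : I x -> I (x * a).
Proof. by rewrite mulrC; apply: idealMl. Qed.
Lemma idealD x y : I x -> I y -> I (x + y).
Proof. by move=> Ix Iy; rewrite -[x]mul1r; apply: I_ideal.2. Qed.
Lemma idealN x : I x -> I (- x).
Proof. by move=> Ix; rewrite -mulN1r; apply: idealMl. Qed.
Lemma idealB x y : I x -> I y -> I (x - y).
Proof. by move=> Ix Iy; apply/idealD/idealN. Qed.
Lemma ideal_sum (J : Type) (r : seq J) (P : pred J) (F : J -> R) :
  (forall i, P i -> I (F i)) -> I (\sum_(i <- r | P i) F i).
Proof. by move=> IF; elim/big_ind: _ => //; [apply: ideal0 | apply: idealD]. Qed.
Lemma ideal_divides a x : I a -> divides a x -> I x.
Proof. by move=> Ia [y ->]; apply: ideal_mulr. Qed.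

End Ideal.

Section PrimeIdeal.
Variables (R : comNzRingType) (Q : set R).
Hypothesis Q_prime : is_prime_ideal Q.
Let Q_ideal : is_ideal Q. Proof. by case: Q_prime. Qed.

Lemma prime_ideal_prod (J : finType) (P : pred J) (F : J -> R) :
  Q (\prod_(i | P i) F i) -> exists2 i, P i & Q (F i).
Proof.
case: Q_prime => _ Q1 QM.
apply: contraPP => /forall2NP nQ; elim/big_ind: _ => //.
- by move=> x y nx ny /QM[].
- by move=> i Pi; case: (nQ i).
Qed.

Lemma prime_idealX x n : Q (x ^+ n) -> Q x.
Proof.
case: Q_prime => _ Q1 QM.
by elim: n => [|n IHn]; rewrite ?expr0 // exprS => /QM[].
Qed.

(** Q meets Z in lZ only: by Bezout, an integer prime to l would put 1 in Q. *)
Lemma prime_ideal_int (l : nat) (a : int) :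
  prime l -> Q l%:R -> Q a%:~R -> (l %| a)%Z.
Proof.
move=> l_pr Ql Qa; apply/negPn/negP => nla.
have la : coprimez l a.
  by rewrite coprimezE absz_nat prime_coprime // -[l]absz_nat -dvdzE.
case/coprimezP: la => -[u v] /= uv; case: Q_prime => _ + _; apply.
have <- : u%:~R * l%:R + v%:~R * a%:~R = 1 :> R.
  by rewrite pmulrn -!intrM -intrD uv.
by apply: idealD => //; apply: idealMl.
Qed.

Lemma prime_ideal_char (m : nat) : (0 < m)%N -> Q m%:R -> exists2 l, prime l & Q l%:R.
Proof.
move=> m0; rewrite [m]prod_prime_decomp // natr_prod => QP.
have : exists2 f, f \in prime_decomp m & Q (f.1 ^ f.2)%:R.
  case: Q_prime => _ Q1 QM; elim: (prime_decomp m) QP => [|f r IHr].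
    by rewrite big_nil.
  rewrite big_cons => /QM[Qf|/IHr[g gr Qg]]; first by exists f; rewrite ?mem_head.
  by exists g; rewrite ?in_cons ?gr ?orbT.
case=> -[l e] /mem_prime_decomp[l_pr _ _]; rewrite /= natrX => /prime_idealX Ql.
by exists l.
Qed.

End PrimeIdeal.

Section Norm.
Variable K : splittingFieldType rat.
Implicit Types (s t : gal_of {:K}) (x y : ringInt K).
Local Notation O := (ringInt K).

Lemma divides_galO s (l : nat) x : divides l%:R x -> divides l%:R (galO s x).
Proof. by move=> [y ->]; exists (galO s y); rewrite rmorphM rmorph_nat. Qed.

Lemma divides_int (l : nat) (a : int) :
  divides l%:R (a%:~R : O) -> (l %| a)%Z.
Proof.
move=> [y ay]; have [l0|l0] := eqVneq l 0%N.
  move: ay; rewrite l0 mul0r -[0]/(0%:~R) => /intr_ringInt_inj ->.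
  by rewrite dvdzz.
have l0' : (l%:R : rat) != 0 by rewrite pnatr_eq0.
have /asboolP := valP y; have -> : val y = (a%:~R / l%:R : rat)%:A.
  have lK : (l%:R : K) != 0.
    by rewrite -(rmorph_nat (in_alg K)) fmorph_eq0.
  apply: (mulfI lK); rewrite -[in LHS](rmorph_nat (val : O -> K)) -rmorphM -ay.
  rewrite rmorph_int -[in RHS](rmorph_nat (in_alg K)) -[RHS](rmorphM (in_alg K)).
  by rewrite mulrCA divff // mulr1; apply/esym/(rmorph_int (in_alg K)).
case/integral_rat => b /(canRL (mulfVK l0')) ab.
have : a = b * l by apply/eqP; rewrite -(eqr_int rat) intrM ab.
by move=> ->; apply: dvdz_mull.
Qed.

Fact normO_exists x : exists a : int, \prod_s galO s x = a%:~R.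
Proof.
apply: galO_fixed => t; rewrite rmorph_prod.
rewrite [RHS](reindex_inj (mulIg t)); apply: eq_bigr => s _.
by rewrite galO_comp.
Qed.
Definition normO x : int := sval (cid (normO_exists x)).
Lemma normOE x : (normO x)%:~R = \prod_s galO s x.
Proof. by rewrite /normO; case: cid. Qed.

Fact traceO_exists x : exists a : int, \sum_s galO s x = a%:~R.
Proof.
apply: galO_fixed => t; rewrite rmorph_sum.
rewrite [RHS](reindex_inj (mulIg t)); apply: eq_bigr => s _.
by rewrite galO_comp.
Qed.
Definition traceO x : int := sval (cid (traceO_exists x)).
Lemma traceOE x : (traceO x)%:~R = \sum_s galO s x.
Proof. by rewrite /traceO; case: cid. Qed.

Lemma normO_cofactor x : (normO x)%:~R = x * \prod_(s | s != 1%g) galO s x.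
Proof. by rewrite normOE (bigD1 1%g) //= galO_id. Qed.

Lemma divides_normO x : divides x (normO x)%:~R.
Proof. by rewrite normO_cofactor; apply: dividesMr. Qed.

Lemma normOM x y : normO (x * y) = normO x * normO y.
Proof.
apply: (@intr_ringInt_inj K); rewrite /= intrM !normOE -big_split /=.
by apply: eq_bigr => s _; rewrite rmorphM.
Qed.

Lemma normO_int (a : int) : normO a%:~R = a ^+ #|{: gal_of {:K}}|.
Proof.
apply: (@intr_ringInt_inj K); rewrite /= normOE rmorphXn /=.
rewrite (eq_bigr (fun=> a%:~R)); last by move=> s _; rewrite rmorph_int.
by rewrite prodr_const.
Qed.

Lemma galO_inj s : injective (@galO K s).
Proof. exact: can_inj (@galOK K s). Qed.

Lemma normO_eq0 x : normO x = 0 -> x = 0.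
Proof.
move/(congr1 (fun a : int => a%:~R : O)); rewrite /= normOE mulr0z.
apply: (big_ind (fun y => y = 0 -> x = 0)) => [/eqP|y z IHy IHz|s _].
- by rewrite oner_eq0.
- by case/ringInt_mul_eq0.
by move=> sx0; apply: (@galO_inj s); rewrite sx0 rmorph0.
Qed.

End Norm.

Section DualBasis.
Variables (K : splittingFieldType rat) (alpha : ringInt K).
Hypothesis alpha_gen : forall s : gal_of {:K}, galO s alpha = alpha -> s = 1%g.
Implicit Types (s t : gal_of {:K}) (x y : ringInt K).
Local Notation O := (ringInt K).

Lemma galO_alpha_inj : injective (fun s => galO s alpha).
Proof.
move=> s t /= st; apply/eqP; rewrite eq_mulgV1; apply/eqP/alpha_gen.
by rewrite galO_comp st galOK.
Qed.

(* f'(alpha), where f is the minimal polynomial of alpha. *)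
Definition different := \prod_(s : gal_of {:K} | s != 1%g) (alpha - galO s alpha).
(** f / (X - alpha), with f the minimal polynomial of alpha. *)
Definition cofactor_poly :=
  \prod_(s : gal_of {:K} | s != 1%g) ('X - (galO s alpha)%:P).

(* Euler's dual basis of the powers of alpha. *)
Lemma different_dual x : different * x =
  \sum_(i < size cofactor_poly) (traceO (cofactor_poly`_i * x))%:~R * alpha ^+ i.
Proof.
set c := cofactor_poly.
(* The s-conjugate of f / (X - alpha) has the roots s(t(alpha)) for t != 1; alpha is among them, at
   t = s^-1, unless s = 1. *)
have E s : \sum_(i < size c) galO s c`_i * alpha ^+ i = different *+ (s == 1%g).
  transitivity (map_poly (galO s) c).[alpha].
    rewrite (@horner_coef_wide _ (size c)) ?size_poly //.
    by apply: eq_bigr => i _; rewrite coef_map.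
  have -> : (map_poly (galO s) c).[alpha] =
      \prod_(t | t != 1%g) (alpha - galO s (galO t alpha)).
    rewrite rmorph_prod horner_prod; apply: eq_bigr => t _.
    by rewrite /= map_polyXsubC hornerXsubC.
  case: eqVneq => [->|s1]; first by apply: eq_bigr => t _; rewrite galO_id.
  by rewrite mulr0n (bigD1 s^-1%g) ?invg_eq1 //= galOKV subrr mul0r.
transitivity (\sum_s galO s x * (different *+ (s == 1%g))).
  rewrite (bigD1 1%g) //= eqxx mulr1n galO_id mulrC big1 ?addr0 // => s /negPf->.
  by rewrite mulr0n mulr0.
under eq_bigr do rewrite -E mulr_sumr.
rewrite exchange_big; apply: eq_bigr => i _ /=.
rewrite traceOE mulr_suml; apply: eq_bigr => s _.
by rewrite rmorphM mulrCA mulrA.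
Qed.

Lemma different_neq0 : normO different != 0.
Proof.
apply/eqP => /normO_eq0 /eqP; apply/negP.
rewrite /different; elim/big_ind: _ => [|x y x0 y0|s s1].
- by rewrite oner_eq0.
- by apply/eqP => /ringInt_mul_eq0[] /eqP; apply/negP.
by apply: contra s1; rewrite subr_eq0 => /eqP/esym/alpha_gen ->.
Qed.

(** The coefficients of [different alpha * x] in Euler's formula are traces lying in Q, hence in lZ.
    Passing to the norm of the different, which is prime to l, allows it to be cancelled. *)
Lemma unramified_inter (l : nat) (Q : set O) x :
  prime l -> ~~ (l %| normO different)%Z -> is_prime_ideal Q -> Q l%:R ->
  (forall s, Q (galO s x)) -> divides l%:R x.
Proof.
move=> l_pr nl Qp Ql Qx; have Qi : is_ideal Q by case: Qp.
apply: (@divides_coprime _ _ (normO different)).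
  by rewrite coprimezE absz_nat prime_coprime // -[l]absz_nat -dvdzE.
rewrite normO_cofactor mulrAC; apply: divides_mulr; rewrite different_dual.
apply: divides_sum => i _; apply: divides_mulr; apply: divides_intr.
apply: (prime_ideal_int Qp) => //; rewrite traceOE; apply: ideal_sum => // s _.
by rewrite rmorphM /=; apply: idealMl.
Qed.

End DualBasis.

(** * Powers of ideals *)

Section IdealPowers.
Variable R : comNzRingType.
Implicit Types (I J P Q : set R) (x y : R).

(** Induction over the sums of products that make up P^k. As [idealX P 0] is the whole ring, [S 0]
    must contain everything. *)
Lemma idealX_ind P (S : nat -> set R) :
    (forall x, S 0%N x) -> (forall k, S k 0) ->
    (forall k x y, S k x -> S k y -> S k (x + y)) ->
    (forall k a b, P a -> S k b -> S k.+1 (a * b)) ->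
  forall k x, idealX P k x -> S k x.
Proof.
move=> S0 Sk0 SD SM; elim=> [//|k IHk] x [s Ps ->].
have: forall p, p \in s -> P p.1 /\ S k p.2.
  by move=> p /Ps[Pp /IHk].
elim: s {Ps} => [|p s IHs] Ps; rewrite ?big_nil // big_cons.
apply: SD; first by have [|Pp Sp] := Ps p; [rewrite mem_head | apply: SM].
by apply: IHs => q qs; apply: Ps; rewrite in_cons qs orbT.
Qed.

Lemma idealM_mem I J x y : I x -> J y -> idealM I J (x * y).
Proof.
by move=> Ix Jy; exists [:: (x, y)]; rewrite ?big_seq1 // => p /[!inE]/eqP->.
Qed.

Lemma idealM_ideal I J : is_ideal I -> is_ideal (idealM I J).
Proof.
move=> Ii; split=> [|a _ _ [r rP ->] [s sP ->]]; first by exists [::]; rewrite ?big_nil.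
exists ([seq (a * p.1, p.2) | p <- r] ++ s) => [p|].
  rewrite mem_cat => /orP[/mapP[q /rP[Iq Jq] ->]|/sP//].
  by split=> //; apply: idealMl.
rewrite big_cat big_map mulr_sumr; congr (_ + _).
by apply: eq_bigr => p _; rewrite mulrA.
Qed.

Lemma idealX_ideal P k : is_ideal P -> is_ideal (idealX P k).
Proof. by case: k => // k; apply: idealM_ideal. Qed.

Lemma idealX_mem P k x : P x -> idealX P k (x ^+ k).
Proof.
by move=> Px; elim: k => [//|k IHk]; rewrite exprS; apply: idealM_mem.
Qed.

Lemma idealX_sub P k : is_ideal P -> (0 < k)%N -> idealX P k `<=` P.
Proof.
move=> Pi; case: k => // k _ x [s sP ->].
rewrite big_seq; apply: ideal_sum => // p /sP[Pp _].
exact: ideal_mulr.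
Qed.

Lemma idealX_morph P Q (f : {rmorphism R -> R}) k :
  (forall x, P x -> Q (f x)) -> is_ideal Q ->
  forall x, idealX P k x -> idealX Q k (f x).
Proof.
move=> PQ Qi; apply: (@idealX_ind P (fun k x => idealX Q k (f x))) => //.
- by move=> j; rewrite rmorph0; apply: ideal0; apply: idealX_ideal.
- move=> j x y Qx Qy; rewrite rmorphD.
  by apply: idealD => //; apply: idealX_ideal.
- by move=> j a b /PQ Qa Qb; rewrite rmorphM; apply: idealM_mem.
Qed.

End IdealPowers.

(** * Prime ideals over an unramified rational prime *)

Section Unramified.
Variables (K : splittingFieldType rat) (alpha : ringInt K).
Implicit Types (s t : gal_of {:K}) (x y : ringInt K).
Local Notation O := (ringInt K).
Variable l : nat.
Hypotheses (l_prime : prime l) (l_unram : ~~ (l %| normO (different alpha))%Z).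
Implicit Types Q : set O.

(** g plays the role of the product of the primes over l other than Q. It is the product over t of
    elements [y t] outside Q which t moves into Q, wherever such an element exists. *)
Lemma prime_ideal_separator Q : is_prime_ideal Q -> Q l%:R ->
  exists2 g, ~ Q g & forall x, Q x -> divides l%:R (g * x).
Proof.
move=> Qp Ql; have [Qi Q1 QM] := Qp.
have /choice[y yP] : forall t, exists y,
    ~ Q y /\ (Q (galO t y) \/ forall z, Q (galO t z) -> Q z).
  move=> t; have [[y [Qy nQy]]|nex] := pselect (exists y, Q (galO t y) /\ ~ Q y).
    by exists y; split=> //; left.
  exists 1; split=> //; right => z Qz; apply: contrapT => nQz; apply: nex.
  by exists z.
exists (\prod_t y t) => [/(prime_ideal_prod Qp)[t _]|x Qx]; first by case: (yP t).
apply: (unramified_inter l_prime l_unram Qp Ql) => t.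
case: (yP t) => _ [Qyt|Qt].
  by rewrite (bigD1 t) //= !rmorphM /= -mulrA; apply: ideal_mulr.
(* Here no such [y t] exists, so t^-1(Q) is contained in Q; as t has finite order, t maps Q into
   Q. *)
rewrite rmorphM; apply: idealMl => //=.
have Qtn n z : Q (galO (t ^+ n)%g z) -> Q z.
  elim: n z => [|n IHn] z; first by rewrite expg0 galO_id.
  by rewrite expgS galO_comp => /IHn/Qt.
apply: (Qtn #[t]%g.-1); rewrite -galO_comp -expgS prednK ?order_gt0 //.
by rewrite expg_order galO_id.
Qed.

(** If every conjugate of the separator g of Q lay in Q', then l would divide g and g would lie in
    Q. Once s(g) is outside Q', the divisibility of s(g) s(x) by l puts s(x) in Q'. *)
Lemma prime_ideal_conj Q Q' : is_prime_ideal Q -> is_prime_ideal Q' ->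
  Q l%:R -> Q' l%:R -> exists s, forall x, Q x -> Q' (galO s x).
Proof.
move=> Qp Q'p Ql Q'l; have [g nQg gQ] := prime_ideal_separator Qp Ql.
have [Qi _ _] := Qp; have [Q'i _ Q'M] := Q'p.
have [s nQ's] : exists s, ~ Q' (galO s g).
  apply: contrapT => /forallNP Q'g; apply: nQg.
  apply: (ideal_divides Qi Ql).
  apply: (unramified_inter l_prime l_unram Q'p Q'l) => s.
  exact: contrapT (Q'g s).
exists s => x /gQ /(divides_galO s)/(ideal_divides Q'i Q'l).
by rewrite rmorphM => /Q'M[].
Qed.

(** For the separator g, l^k divides g^k x and so g^k N(x). Since g^k is outside Q, the factors l
    are extracted from N(x) one at a time. *)
Lemma idealX_dvd_norm Q k x : is_prime_ideal Q -> Q l%:R -> idealX Q k x ->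
  (Posz (l ^ k) %| normO x)%Z.
Proof.
move=> Qp Ql Qx; have [g nQg gQ] := prime_ideal_separator Qp Ql.
have [Qi _ QM] := Qp.
have: divides (l%:R ^+ k) (g ^+ k * x).
  move: k x Qx; apply: (@idealX_ind _ Q (fun k x => divides (l%:R ^+ k) (g ^+ k * x))).
  - by move=> x; rewrite expr0 !mul1r; exists x; rewrite mul1r.
  - by move=> k; rewrite mulr0; apply: divides0.
  - by move=> k x y; rewrite mulrDr; apply: dividesD.
  - by move=> k a b /gQ ga gb; rewrite !exprS mulrACA; apply: dividesMM.
move/(@divides_mulr _ _ _ (\prod_(s | s != 1%g) galO s x)).
rewrite -mulrA -normO_cofactor.
have: ~ Q (g ^+ k) by move/(prime_idealX Qp).
elim: k (g ^+ k) (normO x) {Qx} => [|k IHk] h N nQh; first by rewrite dvd1z.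
rewrite exprS => -[z lz].
have Qh : Q (h * N%:~R) by rewrite lz -mulrA; apply: ideal_mulr.
have /dvdzP[M NM] : (l %| N)%Z by apply: (prime_ideal_int Qp) => //; case: (QM _ _ Qh).
rewrite NM mulrC expnS PoszM dvdz_mul2l -?lt0n ?prime_gt0 //.
apply: (IHk h) => //; exists z; apply: (@ringInt_mulIf _ l%:R).
  by rewrite pmulrn -[0]/(0%:~R) (inj_eq (@intr_ringInt_inj K)) -lt0n prime_gt0.
by rewrite [RHS]mulrA -lz NM intrM -pmulrn mulrC mulrA.
Qed.

End Unramified.

(** * The sieve *)

Section NormBound.
Variable K : splittingFieldType rat.
Local Notation O := (ringInt K).
Local Notation D := #|{: gal_of {:K}}|.

Lemma traceO_lin (I : finType) (n : I -> int) (c : I -> O) :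
  traceO (\sum_i (n i)%:~R * c i) = \sum_i n i * traceO (c i).
Proof.
apply: (@intr_ringInt_inj K); rewrite /= traceOE rmorph_sum /=.
under eq_bigr do rewrite rmorph_sum; rewrite exchange_big; apply: eq_bigr => i _ /=.
rewrite intrM traceOE mulr_sumr; apply: eq_bigr => s _.
by rewrite rmorphM rmorph_int.
Qed.

Lemma traceO_int (a : int) : traceO (a%:~R : O) = a *+ D.
Proof.
apply: (@intr_ringInt_inj K); rewrite /= traceOE rmorphMn /=.
rewrite (eq_bigr (fun=> a%:~R)); last by move=> s _; rewrite rmorph_int.
by rewrite sumr_const.
Qed.

(** D N(x) is the trace of the integer N(x). Expanding the product of conjugates makes it a form of
    degree D in the [v i] with traces as coefficients, so the estimate takes place in Z. *)
Lemma normO_bound (I : finType) (b : I -> O) : exists C : nat,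
  forall (v : I -> int) (Y : nat), (forall i, `|v i|%R <= Posz Y) ->
  `|normO (\sum_i (v i)%:~R * b i)|%R <= Posz (C * Y ^ D).
Proof.
pose c (f : {ffun gal_of {:K} -> I}) := \prod_s galO s (b (f s)).
exists (\sum_f `|traceO (c f)|)%N => v Y vY.
set x := \sum_i _.
have E : normO x *+ D = \sum_(f : {ffun gal_of {:K} -> I}) (\prod_s v (f s)) * traceO (c f).
  rewrite -traceO_int -traceO_lin normOE; congr traceO.
  transitivity (\prod_s \sum_i (v i)%:~R * galO s (b i)).
    apply: eq_bigr => s _; rewrite rmorph_sum; apply: eq_bigr => i _.
    by rewrite rmorphM rmorph_int.
  rewrite bigA_distr_bigA; apply: eq_bigr => f _.
  by rewrite big_split rmorph_prod.
have D0 : (0 < D)%N by apply/card_gt0P; exists 1%g.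
apply: (@le_trans _ _ `|normO x *+ D|).
  by rewrite normrMn -[X in X <= _]mulr1n ler_wpMn2l.
rewrite E (le_trans (ler_norm_sum _ _ _)) //.
rewrite PoszM (big_morph Posz PoszD (erefl _)) mulr_suml ler_sum // => f _.
rewrite normrM mulrC abszE ler_wpM2l // normr_prod.
have -> : Posz (Y ^ D) = \prod_(s : gal_of {:K}) Posz Y.
  by rewrite prodr_const -[LHS]natz natrX natz.
by apply: ler_prod => s _; rewrite normr_ge0 vY.
Qed.

End NormBound.

Section PowersFree.
Variables (K : splittingFieldType rat) (alpha : ringInt K).
Hypothesis alpha_gen : forall s : gal_of {:K}, galO s alpha = alpha -> s = 1%g.
Local Notation O := (ringInt K).
Local Notation D := #|{: gal_of {:K}}|.

(** The D distinct conjugates of alpha are too many roots for a nonzero polynomial of degree below D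
    over the field K. *)
Lemma roots_conj_eq0 (p : {poly O}) : (size p <= D)%N ->
  (forall s : gal_of {:K}, p.[galO s alpha] = 0) -> p = 0.
Proof.
move=> pD p0; apply: (map_inj_poly val_inj (rmorph0 (val : O -> K))).
rewrite rmorph0; apply/eqP/contraT => pn0.
pose rs := [seq val (galO s alpha) | s <- enum {: gal_of {:K}}].
have: (size rs < size (map_poly val p))%N.
  apply: max_poly_roots => //.
    by apply/allP => _ /mapP[s _ ->]; apply/rootP; rewrite horner_map p0 rmorph0.
  rewrite map_inj_uniq ?enum_uniq // => s t /val_inj.
  exact: (galO_alpha_inj alpha_gen).
by rewrite size_map -cardE ltnNge (leq_trans (size_poly _ _)).
Qed.

Lemma powers_free (v : 'I_D -> int) :
  \sum_i (v i)%:~R * alpha ^+ i = 0 -> forall i, v i = 0.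
Proof.
move=> v0; pose p : {poly O} := rVpoly (\row_i (v i)%:~R).
have p0 : p = 0.
  apply: roots_conj_eq0; first exact: size_poly.
  move=> s; rewrite (@horner_coef_wide _ D) ?size_poly //.
  transitivity (galO s (\sum_i (v i)%:~R * alpha ^+ i)).
    2: by rewrite v0 rmorph0.
  rewrite rmorph_sum; apply: eq_bigr => i _.
  by rewrite coef_rVpoly_ord mxE rmorphM rmorphXn rmorph_int.
move=> i; have := coef_rVpoly_ord (\row_i (v i)%:~R : 'rV[O]_D) i.
by rewrite -/p p0 coef0 mxE -(mulr0z 1) => /intr_ringInt_inj.
Qed.

End PowersFree.

(** * Counting estimates for the sieve *)

(** Pigeonhole: a cell of side s contains at most one point of A. *)
Lemma packing (D Y s : nat) (A : {set {ffun 'I_D -> 'I_Y}}) :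
    (forall z z', z \in A -> z' \in A -> (forall i, z i %/ s = z' i %/ s)%N -> z = z') ->
  (#|A| <= (Y %/ s).+1 ^ D)%N.
Proof.
move=> Ainj.
pose f (z : {ffun 'I_D -> 'I_Y}) := [ffun i => inord (z i %/ s) : 'I_(Y %/ s).+1].
rewrite -(card_in_imset (f := f)).
  by rewrite (leq_trans (max_card _)) // card_ffun !card_ord.
move=> z z' zA z'A /ffunP zz'; apply: Ainj => // i.
move: (zz' i); rewrite !ffunE => /(congr1 val).
by rewrite /= !inordK // ltnS leq_div2r // ltnW.
Qed.

(** Comparison with a telescoping sum, from 1/l^2 <= 1/(l-1) - 1/l. *)
Lemma sum_inv_sqr (u : nat -> nat) (X B R : nat) : (0 < B)%N ->
    (forall l, (B < l)%N -> (u l * l ^ 2 <= X)%N) ->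
  (B * \sum_(B.+1 <= l < R.+1) u l <= X)%N.
Proof.
move=> B0 uX; have [RB|BR] := leqP R B; first by rewrite big_geq ?muln0.
(* The subtracted X / R is what carries the induction on R. *)
suff: (\sum_(B.+1 <= l < R.+1) u l)%N%:R <= X%:R / B%:R - X%:R / R%:R :> rat.
  move=> /le_trans/(_ (_ : _ <= X%:R / B%:R)).
  rewrite lerBlDr lerDl divr_ge0 // => /(_ isT).
  by rewrite ler_pdivlMr ?ltr0n // -natrM ler_nat mulnC.
elim: R BR => // R IHR; rewrite ltnS leq_eqVlt => /orP[/eqP<-|BR].
  have Bp : 0 < B%:R :> rat by rewrite ltr0n.
  rewrite big_nat1; have := uX B.+1 (ltnSn B).
  rewrite -(ler_nat rat) natrM natrX -!natr1 => uB.
  have -> : X%:R / B%:R - X%:R / (B%:R + 1) = X%:R / (B%:R * (B%:R + 1)) :> rat.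
    by field; apply/andP; split; apply: lt0r_neq0; lra.
  rewrite ler_pdivlMr; last by nra.
  by apply: le_trans uB; rewrite ler_wpM2l // expr2 ler_wpM2r; lra.
have Rp : 0 < R%:R :> rat by rewrite ltr0n (leq_trans _ BR).
rewrite big_nat_recr /=; last by rewrite ltnS ltnW.
have := uX R.+1 (ltnW _); rewrite ltnS => /(_ BR).
rewrite natrD -(ler_nat rat) natrM natrX -!natr1 => uR.
have uR' : (u R.+1)%:R <= X%:R / R%:R - X%:R / (R%:R + 1) :> rat.
  have -> : X%:R / R%:R - X%:R / (R%:R + 1) = X%:R / (R%:R * (R%:R + 1)) :> rat.
    by field; apply/andP; split; apply: lt0r_neq0; lra.
  rewrite ler_pdivlMr; last by nra.
  by apply: le_trans uR; rewrite ler_wpM2l // expr2 ler_wpM2r; lra.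
have := IHR BR; lra.
Qed.

(** Y is the side of the box, R bounds the primes allowed by norms up to C1 Y^D, and [s l] is the
    separation at l. B0 depends on D and C alone, because in the sieve C1 depends on B through the
    modulus. *)
Lemma sieve_numeric (D C : nat) : (0 < D)%N -> (0 < C)%N ->
  exists B0 : nat, forall B C1 : nat, (B0 < B)%N -> exists Y R : nat, [/\ (0 < Y)%N,
    forall l, (l ^ 2 <= C1 * Y ^ D)%N -> (l <= R)%N
    & forall s : nat -> nat,
       (forall l, (B < l)%N -> (0 < s l)%N /\ (l ^ 2 <= C * s l ^ D)%N) ->
       (1 + \sum_(B.+1 <= l < R.+1) D * (Y %/ s l).+1 ^ D < Y ^ D)%N].
Proof.
(* The factors 3 in M and T cut Y^D into thirds: one for the sum of D (2 (Y / s l))^D, one for the D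
   R due to rounding up, one for the extra 1. Choosing Y = T^2 makes the square root of Y^D an
   integer. *)
move=> D0 C0; pose M := (3 * D * 2 ^ D)%N.
exists (M * C)%N => B C1 MB; pose T := (3 * D * C1 + 4)%N; exists (T ^ 2)%N, (C1 * T ^ D)%N.
have T0 : (0 < T)%N by rewrite /T addn4.
have TD : (T <= T ^ D)%N by rewrite -{1}[T]expn1 leq_pexp2l.
have YD : ((T ^ 2) ^ D = T ^ D * T ^ D)%N by rewrite -expnM mulnC expnM -mulnn.
split=> [|l|s sP]; first by rewrite expn_gt0 T0.
  rewrite YD => l2; rewrite -(@leq_exp2r _ _ 2) //.
  apply: leq_trans l2 _; rewrite -mulnn mulnACA leq_mul2r.
  by case: (C1) => [|c]; rewrite ?muln0 ?leqnn ?orbT // leq_pmulr ?orbT.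
set R := (C1 * T ^ D)%N.
pose u l := ((T ^ 2 %/ s l) ^ D)%N.
have uX : (B * \sum_(B.+1 <= l < R.+1) u l <= C * (T ^ 2) ^ D)%N.
  apply: sum_inv_sqr => [|l Bl]; first exact: leq_ltn_trans MB.
  have [s0 l2] := sP l Bl.
  rewrite (leq_trans (leq_mul (leqnn _) l2)) // mulnCA leq_mul2l -expnMn.
  by rewrite leq_exp2r // leq_divM orbT.
have S3 : (M * \sum_(B.+1 <= l < R.+1) u l <= (T ^ 2) ^ D)%N.
  rewrite -(leq_pmul2l C0) mulnA [(C * M)%N]mulnC (leq_trans _ uX) //.
  by rewrite leq_mul2r ltnW ?orbT.
have S1 : (\sum_(B.+1 <= l < R.+1) D * (T ^ 2 %/ s l).+1 ^ D <=
    D * 2 ^ D * (\sum_(B.+1 <= l < R.+1) u l) + D * R)%N.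
  have -> : (D * R = \sum_(1 <= l < R.+1) D)%N by rewrite sum_nat_const_nat subn1 mulnC.
  rewrite big_distrr /=.
  apply: (@leq_trans (\sum_(B.+1 <= l < R.+1) (D * 2 ^ D * u l + D))%N).
    (* (a + 1)^D <= (2 a)^D + 1, where the last 1 is for a = 0. *)
    apply: leq_sum => l _; rewrite -mulnA -[X in (_ + X)%N]muln1 -mulnDr leq_mul2l -expnMn.
    case: (T ^ 2 %/ s l)%N => [|a]; first by rewrite exp1n leq_addl orbT.
    by rewrite (@leq_trans ((2 * a.+1) ^ D)%N) ?orbT ?leq_addr // leq_exp2r //; lia.
  rewrite big_split leq_add2l.
  case: (leqP B R) => BR; last by rewrite big_geq // ltnS ltnW.
  by rewrite [X in (_ <= X)%N](@big_cat_nat _ _ _ B.+1) //= leq_addl.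
have R3 : (3 * (D * R) < T ^ D * T ^ D)%N.
  rewrite /R !mulnA ltn_mul2r expn_gt0 T0 /= (leq_trans _ TD) //.
  by rewrite /T addn4 ltnS; lia.
have T4 : (4 <= T ^ D * T ^ D)%N.
  have : (4 <= T ^ D)%N by rewrite (leq_trans _ TD) // leq_addl.
  nia.
move: S3 S1; rewrite YD /M; set S := (\sum_(_ <= l < _) u l)%N.
set S' := (\sum_(_ <= l < _) _)%N; rewrite -!mulnA; lia.
Qed.

(** s is the D-th root of m / C, rounded up. *)
Lemma expn_bracket (D C m : nat) : (0 < D)%N -> (0 < C)%N -> (0 < m)%N ->
  exists s, [/\ 0 < s, m <= C * s ^ D & C * s.-1 ^ D < m]%N.
Proof.
move=> D0 C0 m0.
have exs : exists s, (m <= C * s ^ D)%N.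
  exists m; rewrite (@leq_trans (m ^ D)%N) ?leq_pmull //.
  by rewrite -{1}[m]expn1 leq_pexp2l.
case: (ex_minnP exs) => s ms smin; exists s.
have s0 : (0 < s)%N.
  by case: s ms {smin} => //; rewrite exp0n // muln0 leqNgt m0.
split=> //; rewrite ltnNge; apply/negP => /smin.
by case: s s0 {ms smin} => //= s _; rewrite ltnn.
Qed.

Lemma coprime_prod (I : finType) (P : pred I) (F : I -> nat) (m : nat) :
  (forall i, P i -> coprime m (F i)) -> coprime m (\prod_(i | P i) F i).
Proof.
move=> mF; elim/big_ind: _ => //; first exact: coprimen1.
by move=> x y mx my; rewrite coprimeMr mx.
Qed.

Lemma card_bigcup_le (T I : finType) (P : pred I) (A : I -> {set T}) :
  (#|\bigcup_(i | P i) A i| <= \sum_(i | P i) #|A i|)%SET%N.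
Proof.
elim/big_rec2: _ => [|i n U _ Un]; first by rewrite finset.cards0.
by rewrite (leq_trans (leq_card_setU _ _)) ?leq_add2l.
Qed.

(** * A k-free element in a residue class *)

Section Sieve.
Variables (K : splittingFieldType rat) (alpha : ringInt K).
Hypothesis alpha_gen : forall s : gal_of {:K}, galO s alpha = alpha -> s = 1%g.
Local Notation O := (ringInt K).
Local Notation D := #|{: gal_of {:K}}|.

Lemma normO_galO (s : gal_of {:K}) (x : O) : normO (galO s x) = normO x.
Proof.
apply: (@intr_ringInt_inj K); rewrite /= !normOE.
rewrite [RHS](reindex_inj (mulgI s)); apply: eq_bigr => t _.
by rewrite galO_comp.
Qed.

(** Divisibility of (x) by Q^k puts x in Q^k. The norm of x is nonzero and lies in Q, which yields
    the rational prime under Q. *)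
Lemma not_kfree (k : nat) (x : O) : (0 < k)%N -> x <> 0 -> ~ kfree k x ->
  exists l : nat, prime l /\
  exists Q : set O, [/\ is_prime_ideal Q, Q l%:R & idealX Q k x].
Proof.
move=> k0 x0 nx.
have [Q [Qp QX]] : exists Q : set O, is_prime_ideal Q /\ idealX Q k x.
  apply: contrapT => /forallNP nQ; apply: nx; split=> // Q Qp _ [C Ci xC].
  apply: (nQ Q); split=> //.
  have : principal_ideal x x by exists 1; rewrite ?mul1r.
  rewrite xC => -[s sP ->]; case: (Qp) => Qi _ _.
  have QXi := idealX_ideal k Qi; rewrite big_seq; apply: ideal_sum => // c /sP[Qc _].
  exact: ideal_mulr.
have [Qi _ _] := Qp.
have Qx : Q x by apply: idealX_sub QX.
have QN : Q (`|normO x|%N)%:R.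
  have QNx : Q (normO x)%:~R by apply: ideal_divides (divides_normO x).
  by rewrite pmulrn abszEsg intrM; apply: idealMl.
have N0 : (0 < `|normO x|)%N.
  by rewrite absz_gt0; apply/eqP => /normO_eq0.
have [l l_pr Ql] := prime_ideal_char Qp N0 QN.
by exists l; split=> //; exists Q.
Qed.

(** The congruences imposed on the points of the box dispose of the primes over p and over each l <=
    B; [sieve_numeric] counts the points lost to larger l. *)
Lemma kfree_in_class (p k : nat) (y : O) : prime p -> (2 <= k)%N ->
    (forall Q : set O, is_prime_ideal Q -> Q p%:R -> ~ Q y) ->
  exists z : O, kfree k (y + (p ^ k)%:R * z).
Proof.
move=> p_pr k2 yQ; have k0 : (0 < k)%N by apply: ltnW.
have D0 : (0 < D)%N by apply/card_gt0P; exists 1%g.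
have [C' C'P] := normO_bound (fun i : 'I_D => alpha ^+ i).
pose C := C'.+1.
have [B0 B0P] := sieve_numeric D0 (ltn0Sn C').
(* B exceeds B0 for the count, and the norm of the different so that each l > B is unramified. *)
pose B := (B0 + `|normO (different alpha)| + 1)%N.
have B0B : (B0 < B)%N by rewrite /B addn1 ltnS leq_addr.
have B_unram l : (B < l)%N -> ~~ (Posz l %| normO (different alpha))%Z.
  move=> Bl; apply: contraL Bl => /dvdn_leq; rewrite absz_nat -leqNgt => lN.
  by rewrite (leq_trans (lN _)) ?absz_gt0 ?different_neq0 // /B; lia.
pose L := (\prod_(l < B.+1 | prime l && (l != p :> nat)) l)%N.
have pL : coprime (p ^ k) L.
  apply: coprimeXl; apply: coprime_prod => l /andP[l_pr lp].
  by rewrite prime_coprime // dvdn_prime2 // eq_sym.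
pose M := (p ^ k * L)%N.
(* Chinese remainders: x0 is y modulo p^k and 1 modulo L. *)
pose a := chinese (p ^ k) L 1 0; pose b := chinese (p ^ k) L 0 1.
pose x0 : O := a%:R * y + b%:R.
have chin q m r : (m = r %[mod q])%N -> divides q%:R (m%:R - r%:R : O).
  move=> mr; have -> : m%:R - r%:R = (Posz m - Posz r)%:~R :> O by rewrite intrB.
  by apply: divides_intr; rewrite -eqz_mod_dvd; apply/eqP; rewrite !modz_nat mr.
have x0y : divides (p ^ k)%:R (x0 - y).
  have -> : x0 - y = (a%:R - 1%:R) * y + (b%:R - 0%:R) by rewrite /x0; ring.
  apply: dividesD; last exact: chin (chinese_modl pL 0 1).
  by apply: divides_mulr; exact: chin (chinese_modl pL 1 0).
have x01 : divides L%:R (x0 - 1).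
  have -> : x0 - 1 = (a%:R - 0%:R) * y + (b%:R - 1%:R) by rewrite /x0; ring.
  apply: dividesD; last exact: chin (chinese_modr pL 0 1).
  by apply: divides_mulr; exact: chin (chinese_modr pL 1 0).
(* The base point x0 enters as an extra coordinate of constant value 1 <= Y. *)
have [C1 C1P] := normO_bound (fun i : 'I_D.+1 =>
  if unlift ord0 i is Some j then M%:R * alpha ^+ j else x0).
have [Y [R [Y0 RP count]]] := B0P B C1 B0B.
pose lin (v : 'I_D -> int) : O := \sum_i (v i)%:~R * alpha ^+ i.
pose x (z : {ffun 'I_D -> 'I_Y}) := x0 + M%:R * lin (fun i => Posz (z i)).
have linB v w : lin v - lin w = lin (fun i => v i - w i).
  by rewrite /lin -sumrB; apply: eq_bigr => i _; rewrite intrB mulrBl.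
have x_norm z : (`|normO (x z)| <= C1 * Y ^ D)%N.
  rewrite -lez_nat abszE.
  have := C1P (fun i => if unlift ord0 i is Some j then Posz (z j) else 1) Y.
  rewrite big_ord_recl unlift_none mul1r.
  under eq_bigr do rewrite liftK mulrCA.
  rewrite -mulr_sumr -/(lin (fun i => Posz (z i))) -/(x z).
  apply=> i; case: unliftP => [j|] _; last by rewrite normr1 lez_nat.
  by rewrite ger0_norm // lez_nat ltnW.
have [/existsP[z /asboolP zk]|allbad] := boolP [exists z, `[< kfree k (x z) >]].
  have [c x0c] := x0y; exists (c + L%:R * lin (fun i => Posz (z i))).
  suff <- : x z = y + (p ^ k)%:R * (c + L%:R * lin (fun i => Posz (z i))) by [].
  by rewrite mulrDr addrA -x0c mulrA -natrM addrCA addrN addr0.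
have M_coprime l : (B < l)%N -> prime l -> l != p -> coprime l M.
  move=> Bl l_pr lp; rewrite coprimeMr coprimeXr /=.
    apply: coprime_prod => q /andP[q_pr qp].
    by rewrite prime_coprime // dvdn_prime2 // neq_ltn (leq_trans _ Bl) ?orbT ?ltn_ord.
  by rewrite prime_coprime // dvdn_prime2.
have /choice[s sP] : forall l, exists s : nat, (B < l)%N ->
    [/\ 0 < s, l ^ k <= C * s ^ D & C * s.-1 ^ D < l ^ k]%N.
  move=> l; have [Bl|lB] := ltnP B l; last by exists 0%N.
  have [|s ?] := @expn_bracket D C (l ^ k) D0 isT; last by exists s.
  by rewrite expn_gt0 (leq_trans _ Bl).
have /choice[Bad BadP] : forall l, exists Bad : gal_of {:K} -> {set {ffun 'I_D -> 'I_Y}},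
    (B < l)%N ->
    (forall t, #|Bad t| <= (Y %/ s l).+1 ^ D)%N /\
    (forall z (Q : set O), prime l -> l != p -> is_prime_ideal Q -> Q l%:R ->
       idealX Q k (x z) -> exists t, z \in Bad t).
  (* One prime Q over l is fixed. Any other prime over l is carried into Q by some t, so D bad sets,
     one for each t, suffice for l. *)
  move=> l; have [[Q [l_pr lp Qp Ql]]|nQ] := pselect (exists Q : set O,
      [/\ prime l, l != p, is_prime_ideal Q & Q l%:R]); last first.
    exists (fun=> finset.set0) => _; split=> [t|z Q l_pr lp Qp Ql]; first by rewrite finset.cards0.
    by case: nQ; exists Q.
  exists (fun t => [set z | `[< idealX Q k (galO t (x z)) >]]%SET) => Bl.
  have [s0 _ sl] := sP l Bl; have lU := B_unram l Bl; have [Qi _ _] := Qp.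
  split=> [t|z Q' _ _ Q'p Q'l Q'x].
    apply: packing => /= z z'; rewrite !finset.in_set => /asboolP Qz /asboolP Qz' zz'.
    (* Two bad points in one cell: l^k divides the norm of M w, hence that of w as l is prime to M.
       The coordinates of w are below [s l] in absolute value, so this norm is below l^k and w =
       0. *)
    set w := lin (fun i => Posz (z i) - Posz (z' i)).
    have Qw : idealX Q k (galO t (M%:R * w)).
      have -> : M%:R * w = x z - x z' by rewrite /x /w -linB; ring.
      by rewrite rmorphB; apply: (idealB (idealX_ideal k Qi) Qz Qz').
    have := idealX_dvd_norm l_pr lU Qp Ql Qw.
    rewrite normO_galO normOM pmulrn normO_int Gauss_dvdzr; last first.
      by rewrite coprimezE abszX !absz_nat coprimeXl // coprimeXr // M_coprime.
    have wC : (`|normO w| < l ^ k)%N.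
      apply: leq_ltn_trans sl; apply: (@leq_trans (C' * (s l).-1 ^ D)%N).
        rewrite -lez_nat abszE; apply: C'P => i.
        rewrite -abszE lez_nat; move: (zz' i) (divn_eq (z i) (s l)) (divn_eq (z' i) (s l)).
        move=> <-; have := ltn_pmod (z i) s0; have := ltn_pmod (z' i) s0; lia.
      by rewrite leq_mul2r leqnSn orbT.
    move=> lw; have w0 : w = 0.
      apply: normO_eq0; apply/eqP; rewrite -absz_eq0 -leqn0 leqNgt; apply/negP.
      by move/dvdn_leq => /(_ _ lw); rewrite leqNgt wC.
    apply/ffunP => i; apply/val_inj => /=.
    have /eqP := powers_free alpha_gen w0 i.
    by rewrite subr_eq0 => /eqP[].
  have [t tP] := prime_ideal_conj l_pr lU Q'p Qp Q'l Ql.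
  by exists t; rewrite finset.in_set; apply/asboolP; apply: idealX_morph Q'x.
have xzy z : divides (p ^ k)%:R (x z - y).
  have -> : x z - y = (x0 - y) + (p ^ k)%:R * (L%:R * lin (fun i => Posz (z i))).
    by rewrite /x /M natrM; ring.
  by apply: dividesD => //; apply: dividesMr.
have xz1 z : divides L%:R (x z - 1).
  have -> : x z - 1 = (x0 - 1) + L%:R * ((p ^ k)%:R * lin (fun i => Posz (z i))).
    by rewrite /x /M natrM; ring.
  by apply: dividesD => //; apply: dividesMr.
(* Without a k-free point, U is the whole box of Y^D points. The zero of x contributes at most one
   of them. *)
pose U : {set {ffun 'I_D -> 'I_Y}} := ([set z | x z == 0] :|:
  \bigcup_(l < R.+1 | (B < l)%N) \bigcup_t Bad l t)%SET.
have cover z : z \in U.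
  rewrite finset.in_setU finset.in_set; have [//|xz0] := eqVneq (x z) 0.
  have [|l [l_pr [Q [Qp Ql Qx]]]] := @not_kfree k (x z) k0 (elimN eqP xz0).
    move=> xk; case/negP: allbad; apply/existsP; exists z; exact/asboolP.
  have [Qi Q1 _] := Qp; have Qxz : Q (x z) by apply: idealX_sub Qx.
  have lp : l != p.
    apply/eqP => lp; rewrite lp in Ql; apply: (yQ Q Qp Ql).
    rewrite -[y](subKr (x z)); apply: idealB => //.
    apply: (ideal_divides Qi Ql); apply: divides_trans (xzy z).
    by apply: divides_nat; rewrite dvdn_exp.
  have Bl : (B < l)%N.
    rewrite ltnNge; apply/negP => lB; apply: Q1.
    rewrite -[1](subKr (x z)); apply: idealB => //.
    apply: (ideal_divides Qi Ql); apply: divides_trans (xz1 z).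
    apply: divides_nat; rewrite /L (bigD1 (Ordinal (lB : l < B.+1)%N)) /= ?l_pr //.
    exact: dvdn_mulr.
  (* l^2 <= l^k <= |N(x z)| <= C1 Y^D. *)
  have lR : (l <= R)%N.
    apply: RP; apply: leq_trans (x_norm z).
    apply: (@leq_trans (l ^ k)%N); first by rewrite (@leq_exp2l l 2 k (prime_gt1 l_pr)).
    have := idealX_dvd_norm l_pr (B_unram l Bl) Qp Ql Qx.
    rewrite dvdzE absz_nat; apply: dvdn_leq.
    by rewrite absz_gt0; apply: contra xz0 => /eqP/normO_eq0/eqP.
  have [_ /(_ z Q l_pr lp Qp Ql Qx)[t zt]] := BadP l Bl.
  apply/finset.bigcupP; exists (Ordinal (lR : l < R.+1)%N) => //.
  by apply/finset.bigcupP; exists t.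
suff : (#|[set: {ffun 'I_D -> 'I_Y}]%SET| < Y ^ D)%N.
  by rewrite cardsT card_ffun !card_ord ltnn.
apply: (leq_ltn_trans _ (count s _)) => [|l Bl]; last first.
  have [s0 sl _] := sP l Bl; split=> //; apply: leq_trans sl.
  by rewrite leq_exp2l // (leq_ltn_trans _ Bl) // /B addn1.
apply: (@leq_trans #|U|); first by apply/subset_leq_card/fintype.subsetP => z _; apply: cover.
apply: (leq_trans (leq_card_setU _ _)); apply: leq_add.
  apply/fintype.card_le1_eqP => z z'; rewrite !finset.in_set => /eqP xz /eqP xz'.
  apply/ffunP => i; apply/val_inj => /=.
  have M0 : (M%:R : O) != 0.
    rewrite pmulrn -(mulr0z 1) (inj_eq (@intr_ringInt_inj K)).
    rewrite -lt0n muln_gt0 expn_gt0 prime_gt0 //=.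
    by apply: prodn_cond_gt0 => j /andP[/prime_gt0].
  have w0 : lin (fun i => Posz (z i) - Posz (z' i)) = 0.
    apply: (ringInt_mulIf M0); rewrite mulr0 -linB.
    by rewrite -[RHS](subrr (x z)) {2}xz -xz' /x; ring.
  have /eqP := powers_free alpha_gen w0 i.
  by rewrite subr_eq0 => /eqP[].
apply: (leq_trans (card_bigcup_le _ _)).
rewrite (big_nat_widenl B.+1 0) // big_mkord; apply: leq_sum => l Bl.
apply: (leq_trans (card_bigcup_le _ _)).
have [Badl _] := BadP l Bl.
apply: (@leq_trans (\sum_(t : gal_of {:K}) (Y %/ s l).+1 ^ D)%N).
  exact: leq_sum.
by rewrite sum_nat_const.
Qed.

End Sieve.

(** * Completely split primes *)

Section SplitPrimes.
Variables (K : splittingFieldType rat) (alpha : ringInt K).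
Hypothesis alpha_gen : forall s : gal_of {:K}, galO s alpha = alpha -> s = 1%g.
Local Notation O := (ringInt K).
Local Notation D := #|{: gal_of {:K}}|.

Lemma divides_prodB (R : comNzRingType) (a : R) (I : Type) (r : seq I) (F G : I -> R) :
  (forall i, divides a (F i - G i)) ->
  divides a (\prod_(i <- r) F i - \prod_(i <- r) G i).
Proof.
move=> FG; elim/big_ind2: _ => // [|x' x y' y xx' yy'].
  by rewrite subrr; apply: divides0.
have -> : x * y - x' * y' = x * (y - y') + y' * (x - x') by ring.
by apply: dividesD; apply: dividesMl.
Qed.

(* The hypothesis on alpha makes the values at the multiples of b`! congruent
   to +-1 mod b`!, hence prime to all primes p <= b. *)
Lemma infinitely_many_split_primes (b : nat) : `|normO alpha|%N = 1%N ->
  exists p m : nat, [/\ prime p, (b < p)%N & (Posz p %| normO (m%:R - alpha))%Z].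
Proof.
move=> alpha_unit; pose N j := normO ((b`! * j)%:R - alpha).
have N0 : `|normO (- alpha)|%N = 1%N.
  by rewrite -mulN1r normOM abszM alpha_unit -[-1]/((-1)%:~R) normO_int abszX muln1 exp1n.
have NN0 j : (Posz b`! %| N j - normO (- alpha))%Z.
  apply: (@divides_int K); rewrite intrB !normOE; apply: divides_prodB => s.
  by rewrite -rmorphB opprK subrK rmorph_nat natrM; apply: dividesMr.
(* Otherwise f^2 - 1, a nonzero polynomial, would vanish at all multiples of b!. *)
have [j Nj] : exists j, `|N j|%N != 1%N.
  apply: contrapT => /forallNP allj.
  pose f : {poly O} := \prod_s ('X - (galO s alpha)%:P).
  have size_f : (1 < size f)%N.
    rewrite size_prod_XsubC ltnS; have := mem_index_enum (1%g : gal_of {:K}).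
    by case: (index_enum _).
  have fN (m : nat) : f.[m%:R] = (normO (m%:R - alpha))%:~R.
    rewrite normOE horner_prod; apply: eq_bigr => s _.
    by rewrite hornerXsubC rmorphB rmorph_nat.
  pose g := map_poly (val : O -> K) (f ^+ 2 - 1).
  have g0 : g != 0.
    rewrite /g rmorphB rmorphXn rmorph1 subr_eq0; apply/eqP => /(congr1 (size : {poly K} -> nat)).
    rewrite size_poly1 => s1.
    have := size_exp (map_poly (val : O -> K) f) 2.
    rewrite s1 size_map_inj_poly ?rmorph0 //; last exact: val_inj.
    by move: size_f; case: (size f) => [|[|n]].
  pose rs := [seq (b`! * j)%:R : K | j <- iota 0 (size g)].
  have: (size rs < size g)%N.
    apply: max_poly_roots => //.
      apply/allP => _ /mapP[j _ ->]; apply/rootP.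
      have -> : (b`! * j)%:R = val ((b`! * j)%:R : O) by rewrite rmorph_nat.
      rewrite horner_map !hornerE fN.
      have /negP := allj j; rewrite negbK => /eqP N1.
      have: normO ((b`! * j)%:R - alpha) ^+ 2 = 1.
        by rewrite -/(N j) -[LHS]gez0_abs ?sqr_ge0 // abszX N1.
      by rewrite -rmorphXn => ->; rewrite subrr rmorph0.
    rewrite map_inj_uniq ?iota_uniq // => i j.
    rewrite -!(rmorph_nat (val : O -> K)) => /val_inj.
    rewrite !pmulrn => /intr_ringInt_inj[] /eqP.
    by rewrite eqn_pmul2l ?fact_gt0 // => /eqP.
  by rewrite size_map size_iota ltnn.
have [Nj0|Nj0] := eqVneq `|N j|%N 0%N.
  case: (prime_above b) => p bp p_pr; exists p, (b`! * j)%N; split=> //.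
  by move/eqP: Nj0; rewrite absz_eq0 => /eqP Nj0; rewrite -/(N j) Nj0 dvdz0.
have Nj1 : (1 < `|N j|)%N by lia.
(* A prime factor up to b would divide b! and hence N(-alpha), which is 1 or -1. *)
exists (pdiv `|N j|), (b`! * j)%N; split; rewrite ?pdiv_prime //; last exact: pdiv_dvd.
rewrite ltnNge; apply/negP => pb.
have pbf : (pdiv `|N j| %| b`!)%N by rewrite dvdn_fact // pdiv_gt0.
have p1 : (Posz (pdiv `|N j|) %| normO (- alpha))%Z.
  rewrite -[normO _](subKr (N j)) rpredB //; first exact: pdiv_dvd.
  exact: dvdz_trans (NN0 j).
by move: p1; rewrite dvdzE N0 absz_nat dvdn1 => /eqP p1; have := pdiv_prime Nj1; rewrite p1.
Qed.

Definition cofactor (x : O) := \prod_(s : gal_of {:K} | s != 1%g) galO s x.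

(** Lagrange interpolation of the constant 1 at the conjugates of alpha, evaluated at m and
    multiplied by N(f'(alpha)) to clear denominators. *)
Lemma lagrange_one (m : int) :
  \sum_s galO s (cofactor (different alpha) * cofactor (m%:~R - alpha)) =
    (normO (different alpha))%:~R.
Proof.
pose d' := cofactor (different alpha).
pose P s := \prod_(t : gal_of {:K} | t != 1%g) ('X - (galO s (galO t alpha))%:P).
have PE s z : (P s).[z] = \prod_(t : gal_of {:K} | t != 1%g) (z - galO s (galO t alpha)).
  by rewrite horner_prod; apply: eq_bigr => t _; rewrite hornerXsubC.
pose g : {poly O} := \sum_s (galO s d')%:P * P s - (normO (different alpha))%:~R%:P.
have D0 : (0 < D)%N by apply/card_gt0P; exists 1%g.
have g0 : g = 0.
  apply: (roots_conj_eq0 alpha_gen) => [|u].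
    rewrite (leq_trans (size_polyD _ _)) // geq_max size_polyN.
    rewrite (leq_trans (size_polyC_leq1 _)) // andbT.
    apply: leq_trans (size_sum _ _ _) _; apply/bigmax_leqP => s _.
    rewrite mul_polyC (leq_trans (size_scale_leq _ _)) //.
    rewrite /P -big_filter size_prod_XsubC size_filter -sum1_count sum1_card.
    by rewrite cardC1 prednK.
  (* At u(alpha) only the term s = u survives; the others have a zero factor at t = u s^-1. *)
  rewrite /g hornerD hornerN hornerC horner_sum (bigD1 u) // big1 => [|s su].
    rewrite [X in X - _]addr0 hornerM hornerC PE.
    under eq_bigr do rewrite -rmorphB.
    rewrite -rmorph_prod -rmorphM -/(different alpha) mulrC -normO_cofactor.
    by rewrite rmorph_int subrr.
  rewrite hornerM PE (bigD1 (u * s^-1)%g).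
    by rewrite -galO_comp mulgKV subrr [X in _ * X]mul0r mulr0.
  by apply: contra su => /eqP/(canRL (mulgKV s)); rewrite mul1g => ->.
have /eqP := congr1 (fun q : {poly O} => q.[m%:~R]) g0.
rewrite /= horner0 hornerD hornerN hornerC horner_sum subr_eq0 => /eqP <-.
apply: eq_bigr => s _; rewrite hornerM hornerC PE rmorphM.
congr (_ * _); rewrite rmorph_prod; apply: eq_bigr => t _.
by rewrite !rmorphB !rmorph_int.
Qed.

(* For q = p ^ k, e is the idempotent of O / q cutting out the completion at a
   prime of degree one over p. *)
Definition split_idempotent (q : nat) (e : O) :=
  [/\ divides q%:R (\sum_s galO s e - 1),
      forall s : gal_of {:K}, s != 1%g -> divides q%:R (e * galO s e)
    & forall x, exists c : int, divides q%:R (x * e - c%:~R * e)].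


Lemma coprime_inverse (q : nat) (a : int) : coprimez q a ->
  exists w : int, (Posz q %| w * a - 1)%Z.
Proof.
case/coprimezP => -[u w] /= uw; exists w.
by rewrite -uw opprD addrCA subrr addr0 -mulNr dvdz_mull.
Qed.

(** e is the Lagrange term at m, scaled by the inverse w of the norm of the different mod p. It is
    killed by m - alpha mod p, so alpha acts on it as the integer m. *)
Lemma split_idempotent_prime (p m : nat) :
    prime p -> ~~ (p %| normO (different alpha))%Z ->
    (Posz p %| normO (m%:R - alpha))%Z ->
  exists e, split_idempotent p e.
Proof.
move=> p_pr p_unram pN.
have p_coprime (a : int) : ~~ (p %| a)%Z -> coprimez p a.
  by move=> pa; rewrite coprimezE absz_nat prime_coprime // -[p]absz_nat -dvdzE.
set Delta := normO (different alpha); set d' := cofactor (different alpha).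
have [w wD] := coprime_inverse (p_coprime _ p_unram).
pose eta := cofactor (m%:R - alpha); pose e := w%:~R * (d' * eta).
have etaN : (m%:R - alpha) * eta = (normO (m%:R - alpha))%:~R.
  by rewrite normO_cofactor.
have pN' : divides p%:R ((m%:R - alpha) * eta) by rewrite etaN; apply: divides_intr.
have sum_e : divides p%:R (\sum_s galO s e - 1).
  rewrite (eq_bigr (fun s => w%:~R * galO s (d' * eta))); last first.
    by move=> s _; rewrite rmorphM rmorph_int.
  have := lagrange_one m; rewrite -pmulrn -/eta -/d' => E.
  rewrite -mulr_sumr E -intrM -[X in _ - X]/(1%:~R) -intrB.
  exact: divides_intr.
have e_neq0 : ~ divides p%:R e.
  move=> pe; have: divides p%:R (1 : O).
    rewrite -[X in divides _ X](subKr (\sum_s galO s e)); apply: dividesB => //.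
    by apply: divides_sum => s _; apply: divides_galO.
  rewrite -[X in divides _ X]/(1%:~R) => /divides_int; rewrite dvdzE absz_nat dvdn1 => /eqP p1.
  by rewrite p1 in p_pr.
have alpha_e i : divides p%:R (alpha ^+ i * e - m%:R ^+ i * e).
  elim: i => [|i IHi]; first by rewrite subrr; apply: divides0.
  have -> : alpha ^+ i.+1 * e - m%:R ^+ i.+1 * e =
      alpha * (alpha ^+ i * e - m%:R ^+ i * e) -
      m%:R ^+ i * (w%:~R * d') * ((m%:R - alpha) * eta).
    by rewrite !exprS /e; ring.
  by apply: dividesB; apply: dividesMl.
(* [different alpha * x] is an integer polynomial in alpha, so it acts on e as an integer F.
   Dividing by F1, the integer by which the different itself acts, gives the action of x. *)
have diff_e x : exists F : int, divides p%:R (different alpha * x * e - F%:~R * e).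
  pose n i := traceO ((cofactor_poly alpha)`_i * x).
  exists (\sum_(i < size (cofactor_poly alpha)) n i * m%:Z ^+ i).
  rewrite different_dual mulr_suml rmorph_sum mulr_suml -sumrB.
  apply: divides_sum => i _; rewrite rmorphM rmorphXn /= -pmulrn -!mulrA -mulrBr.
  exact: dividesMl.
have [F1] := diff_e 1; rewrite mulr1 => F1P.
have pF1 : ~~ (p %| F1)%Z.
  apply/negP => pF1; apply: e_neq0; apply: (divides_coprime (p_coprime _ p_unram)).
  rewrite normO_cofactor mulrAC; apply: divides_mulr; apply: divides_congr F1P _.
  by apply: divides_mulr; apply: divides_intr.
have [v vF1] := coprime_inverse (p_coprime _ pF1).
exists e; split=> // [s s1|x].
  (* [galO s eta] has the factor m - alpha at the index s^-1, and (m - alpha) eta is a norm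
     divisible by p. *)
  rewrite /e rmorphM (rmorphM _ d') /= mulrACA; apply: dividesMl.
  rewrite mulrACA; apply: dividesMl.
  rewrite [galO s eta]rmorph_prod (bigD1 s^-1%g) ?invg_eq1 //= galOKV.
  by rewrite [eta * _]mulrA [eta * _]mulrC; apply: divides_mulr.
have [F FP] := diff_e x; exists (v * F).
have -> : x * e - (v * F)%:~R * e =
    v%:~R * (different alpha * x * e - F%:~R * e)
    - v%:~R * x * (different alpha * e - F1%:~R * e) - (v * F1 - 1)%:~R * (x * e).
  by rewrite !intrB !intrM; ring.
apply: dividesB; last by apply/divides_mulr/divides_intr.
by apply: dividesB; apply: dividesMl.
Qed.

Lemma split_idempotentK q e : split_idempotent q e -> divides q%:R (e * e - e).
Proof.
case=> e1 e_orth _.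
have -> : e * e - e = e * (\sum_s galO s e - 1) - \sum_(s : gal_of {:K} | s != 1%g) e * galO s e.
  by rewrite (bigD1 1%g) //= galO_id -mulr_sumr; ring.
by apply: dividesB; [apply: dividesMl | apply: divides_sum].
Qed.

(** E = w e^k. Since p divides e s(e), p^k divides its k-th power; the trace of e^k is 1 mod p, and
    its inverse w mod p^k restores the sum 1. *)
Lemma split_idempotent_lift (p k : nat) e : prime p -> (0 < k)%N ->
  split_idempotent p e -> exists E, split_idempotent (p ^ k) E.
Proof.
move=> p_pr k0 eP; have ee := split_idempotentK eP; have [e1 e_orth e_int] := eP.
have ek : divides p%:R (e ^+ k - e).
  case: k k0 => // k _; elim: k => [|k IHk]; first by rewrite expr1 subrr; apply: divides0.
  have -> : e ^+ k.+2 - e = e * (e ^+ k.+1 - e) + (e * e - e) by rewrite [e ^+ k.+2]exprS; ring.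
  by apply: dividesD => //; apply: dividesMl.
set u := traceO (e ^+ k).
have u1 : (p %| u - 1)%Z.
  apply: (@divides_int K); rewrite intrB traceOE.
  have -> : \sum_s galO s (e ^+ k) - 1 = \sum_s galO s (e ^+ k - e) + (\sum_s galO s e - 1).
    by rewrite addrA -big_split /=; congr (_ - _); apply: eq_bigr => s _; rewrite rmorphB subrK.
  by apply: dividesD => //; apply: divides_sum => s _; apply: divides_galO.
have pu : coprimez (p ^ k)%N u.
  rewrite coprimezE absz_nat coprimeXl // prime_coprime //; apply/negP => pu.
  have : (p %| (1 : int))%Z by rewrite -(subKr u 1) rpredB.
  by rewrite dvdzE absz_nat dvdn1 => /eqP p1; rewrite p1 in p_pr.
have [w wu] := coprime_inverse pu; pose E := w%:~R * e ^+ k.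
have wu' : (p %| w * u - 1)%Z.
  by apply: dvdz_trans wu; rewrite dvdzE !absz_nat -{1}[p]expn1 dvdn_exp2l.
have w1 : (p %| w - 1)%Z.
  have -> : w - 1 = (w * u - 1) - w * (u - 1) by ring.
  by rewrite rpredB // dvdz_mull.
have Ee : divides p%:R (E - e).
  have -> : E - e = (w - 1)%:~R * e ^+ k + (e ^+ k - e) by rewrite /E intrB; ring.
  by apply: dividesD => //; apply/divides_mulr/divides_intr.
have E1 : divides (p ^ k)%:R (\sum_s galO s E - 1).
  rewrite (eq_bigr (fun s => w%:~R * galO s (e ^+ k))); last first.
    by move=> s _; rewrite rmorphM rmorph_int.
  rewrite -mulr_sumr -traceOE -intrM -[X in _ - X]/(1%:~R) -intrB.
  exact: divides_intr.
have E_orth s : s != 1%g -> divides (p ^ k)%:R (E * galO s E).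
  move=> s1; rewrite /E rmorphM rmorphXn rmorph_int mulrACA -exprMn natrX.
  by apply/dividesMl/dividesX/e_orth.
have EK : divides (p ^ k)%:R (E * E - E).
  have -> : E * E - E = E * (\sum_s galO s E - 1) - \sum_(s : gal_of {:K} | s != 1%g) E * galO s E.
    by rewrite (bigD1 1%g) //= galO_id -mulr_sumr; ring.
  by apply: dividesB; [apply: dividesMl | apply: divides_sum].
exists E; split=> // x.
(* Successive approximation of the integer c, one power of p at a time. *)
suff appr j : exists (c : int) y, divides (p ^ k)%:R (x * E - c%:~R * E - (p ^ j)%:R * y * E).
  have [c [y cP]] := appr k; exists c.
  rewrite -[X in divides _ X](subrK ((p ^ k)%:R * y * E)); apply: dividesD => //.
  by rewrite -mulrA; apply: dividesMr.
elim: j => [|j [c [y cP]]].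
  by exists 0, x; rewrite expn0 mul1r mul0r subr0 subrr; apply: divides0.
have [c' [y' c'P]] : exists c' : int, divides p%:R (y * E - c'%:~R * E).
  have [c' c'P] := e_int y; exists c'.
  have -> : y * E - c'%:~R * E = (y - c'%:~R) * (E - e) + (y * e - c'%:~R * e) by ring.
  by apply: dividesD => //; apply: dividesMl.
exists (c + (p ^ j)%N%:Z * c'), y'.
have -> : x * E - (c + (p ^ j)%N%:Z * c')%:~R * E - (p ^ j.+1)%:R * y' * E =
    (x * E - c%:~R * E - (p ^ j)%:R * y * E) - (p ^ j)%:R * (y - c'%:~R) * (E * E - E).
  have -> : (p ^ j.+1)%:R * y' * E = (p ^ j)%:R * (y * E - c'%:~R * E) * E.
    by rewrite c'P expnS natrM; ring.
  by rewrite intrD intrM -pmulrn; ring.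
by apply: dividesB => //; apply: dividesMl.
Qed.

End SplitPrimes.

(** * Residue maps given by split idempotents *)

Section SplitIdempotent.
Variable K : splittingFieldType rat.
Local Notation O := (ringInt K).
Implicit Types (e x : O).

Lemma split_idempotentW q r e : (r %| q)%N ->
  split_idempotent q e -> split_idempotent r e.
Proof.
move=> rq; have W x : divides q%:R x -> divides (r%:R : O) x.
  by apply: divides_trans; apply: divides_nat.
case=> e1 e_orth e_int; split=> [|s s1|x].
- exact: W.
- exact/W/e_orth.
- by have [c cP] := e_int x; exists c; apply: W.
Qed.

(** Summing the conjugates of c e recovers c mod q. *)
Lemma split_idempotent_int q e (c : int) : split_idempotent q e ->
  divides q%:R (c%:~R * e) -> (q %| c)%Z.
Proof.
case=> e1 _ _ ce; apply: (@divides_int K).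
have -> : c%:~R = \sum_s galO s (c%:~R * e) - c%:~R * (\sum_s galO s e - 1).
  rewrite (eq_bigr (fun s => c%:~R * galO s e)) -?mulr_sumr; first by ring.
  by move=> s _; rewrite rmorphM rmorph_int.
apply: dividesB; last exact: dividesMl.
by apply: divides_sum => s _; apply: divides_galO.
Qed.

Lemma split_idempotent_galO q e s t : split_idempotent q e -> s != t ->
  divides q%:R (galO s e * galO t e).
Proof.
case=> _ e_orth _ st.
have -> : galO s e * galO t e = galO s (e * galO (t * s^-1)%g e).
  by rewrite rmorphM /= -galO_comp mulgKV.
apply/divides_galO/e_orth; apply: contra st => /eqP/(canRL (mulgKV s)).
by rewrite mul1g => ->.
Qed.

Lemma split_idempotent_dvd_norm q e x : split_idempotent q e ->
  divides q%:R (x * e) -> (q %| normO x)%Z.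
Proof.
move=> eP xe; apply: (split_idempotent_int eP).
by rewrite normO_cofactor mulrAC; apply: divides_mulr.
Qed.

(* The prime P is the kernel of the residue map x |-> c given by x * e = c e
   mod p; the cofactor of P ^ k in (t) is the colon ideal ((t) : P ^ k). *)
Lemma split_not_kfree (p k : nat) e t : prime p -> (0 < k)%N ->
  split_idempotent (p ^ k) e -> divides (p ^ k)%:R (t * e) -> ~ kfree k t.
Proof.
move=> p_pr k0 eP te [t0 nP].
have pk : (p %| p ^ k)%N by rewrite dvdn_exp.
have eP1 := split_idempotentW pk eP.
pose P : set O := [set x | divides p%:R (x * e)].
have Pi : is_ideal P.
  split; rewrite /P /=; first by rewrite mul0r; apply: divides0.
  by move=> a x y Px Py; rewrite mulrDl -mulrA; apply: dividesD => //; apply: dividesMl.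
have Pp : P p%:R by apply: dividesMr.
have Pprime : is_prime_ideal P.
  split=> //; rewrite /P /=.
    move/(split_idempotent_int (c := 1) eP1).
    by rewrite dvdzE absz_nat dvdn1 => /eqP p1; rewrite p1 in p_pr.
  have [_ _ e_int] := eP1.
  move=> x y; have [[c cP] [d dP]] := (e_int x, e_int y) => xye.
  have : (p %| c * d)%Z.
    apply: (split_idempotent_int eP1); apply: divides_congr xye.
    have -> : (c * d)%:~R * e - x * y * e =
        - (y * (x * e - c%:~R * e) + c%:~R * (y * e - d%:~R * e)) by rewrite intrM; ring.
    by apply/dividesN/dividesD; apply: dividesMl.
  rewrite dvdzE absz_nat abszM Euclid_dvdM // => /orP[pc|pd]; [left|right].
    by apply: divides_congr cP _; apply/divides_mulr/divides_intr.
  by apply: divides_congr dP _; apply/divides_mulr/divides_intr.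
have p0 : (p ^ k)%:R != 0 :> O.
  rewrite pmulrn -(mulr0z 1) (inj_eq (@intr_ringInt_inj K)).
  by rewrite -lt0n expn_gt0 prime_gt0.
(* Each factor from P contributes one p; e can be duplicated since it is idempotent mod p^k, hence
   mod p^j for j <= k. *)
have PX r : idealX P k r -> divides (p ^ k)%:R (r * e).
  suff PXj j : idealX P j r -> (j <= k)%N -> divides (p ^ j)%:R (r * e) by move/PXj; apply.
  move: j r; apply: (@idealX_ind _ P (fun j r => (j <= k)%N -> divides (p ^ j)%:R (r * e))).
  - by move=> r _; exists (r * e); rewrite mul1r.
  - by move=> j _; rewrite mul0r; apply: divides0.
  - by move=> j r r' Pr Pr' jk; rewrite mulrDl; apply: dividesD; [apply: Pr | apply: Pr'].
  move=> j a b Pa Pb jk.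
  have -> : a * b * e = a * e * (b * e) - a * b * (e * e - e) by ring.
  apply: dividesB; first by rewrite expnS natrM; apply: (dividesMM Pa); apply/Pb/ltnW.
  apply/dividesMl/(divides_trans _ (split_idempotentK eP)).
  by apply: divides_nat; rewrite dvdn_exp2l.
apply: (nP P Pprime).
  move=> P0; move: Pp; rewrite P0 => /= /eqP; rewrite pmulrn -(mulr0z 1).
  by rewrite (inj_eq (@intr_ringInt_inj K)) -[_ == _]/(p == 0)%N -leqn0 leqNgt prime_gt0.
pose C : set O := [set c | forall r, idealX P k r -> divides t (r * c)].
exists C.
  split=> [r _|a x y Cx Cy r Pr]; first by rewrite mulr0; apply: divides0.
  by rewrite mulrDr mulrCA; apply: dividesD; [apply/dividesMl/Cx | apply: Cy].
apply/seteqP; split=> [_ [a _ <-]|_ [s sP ->]]; last first.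
  suff [a ->] : divides t (\sum_(c <- s) c.1 * c.2) by exists a; rewrite // mulrC.
  by rewrite big_seq; apply: divides_sum => c /sP[Pc Cc]; apply: Cc.
apply: idealMl; first exact/idealM_ideal/idealX_ideal.
(* 1 - e lies in P. With t e = p^k y this gives t = p^k (y h) + (1 - e)^k t, where p^k and (1 - e)^k
   lie in P^k, and y h and t in C. *)
have [h hE] : exists h, (1 - e) ^+ k = 1 - e * h.
  have /(_ k)[h hE] : forall j, exists h, (1 - e) ^+ j = 1 - e * h.
    elim=> [|j [h IHj]]; first by exists 0; rewrite expr0 mulr0 subr0.
    by exists (1 + h - e * h); rewrite exprS IHj; ring.
  by exists h.
have [y yE] := te.
have -> : t = (p ^ k)%:R * (y * h) + (1 - e) ^+ k * t by rewrite mulrA -yE hE; ring.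
apply: idealD; first exact/idealM_ideal/idealX_ideal.
  apply: idealM_mem; first by rewrite natrX; apply: idealX_mem.
  move=> r /PX[z zE]; exists (z * h); apply: (ringInt_mulIf p0).
  have -> : (p ^ k)%:R * (r * (y * h)) = r * ((p ^ k)%:R * y) * h by ring.
  rewrite -yE; have -> : r * (t * e) * h = t * (r * e) * h by ring.
  by rewrite zE; ring.
apply: idealM_mem; last by move=> r _; apply/dividesMl; exists 1; rewrite mulr1.
apply: idealX_mem; rewrite /P /= mulrBl mul1r -[_ - _]opprB; apply: dividesN.
exact: split_idempotentK.
Qed.

End SplitIdempotent.

Lemma dvdz_nat_prime (p : nat) (a b : int) : prime p ->
  (p %| a * b)%Z -> (p %| a)%Z \/ (p %| b)%Z.
Proof. by move=> p_pr; rewrite !dvdzE absz_nat abszM Euclid_dvdM // => /orP. Qed.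

(** All coordinates are 1 except [v j] = t and [v i], for which the equation is solved mod p^k. If t
    = 1 makes [v i] divisible by p, then t = 2 does not; p > 2 keeps 2 prime to p. *)
Lemma linear_form_zero (I : finType) (p k : nat) (a : I -> int) (i j : I) :
    prime p -> (2 < p)%N -> (0 < k)%N -> i != j -> ~~ (p %| a i)%Z -> ~~ (p %| a j)%Z ->
  exists v : I -> int, (forall l, ~~ (p %| v l)%Z) /\
    (Posz (p ^ k) %| \sum_l v l * a l)%Z.
Proof.
move=> p_pr p2 k0 ij pi pj.
have [w wi] : exists w : int, (Posz (p ^ k) %| w * a i - 1)%Z.
  apply: coprime_inverse; rewrite coprimezE absz_nat coprimeXl //.
  by rewrite prime_coprime // -[p]absz_nat -dvdzE.
have p_small (c : nat) : (0 < c < p)%N -> ~~ (p %| Posz c)%Z.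
  by case/andP=> c0 cp; rewrite dvdzE !absz_nat gtnNdvd.
have pw : ~~ (p %| w)%Z.
  apply/negP => pw; have /negP := p_small 1%N (ltnW p2 : (0 < 1 < p)%N); apply.
  rewrite -[Posz 1](subKr (w * a i)) rpredB ?dvdz_mulr //.
  by apply: dvdz_trans wi; rewrite dvdzE !absz_nat dvdn_exp.
pose S := \sum_(l | (l != i) && (l != j)) a l.
have [t t12 tS] : exists2 t : nat, (0 < t < p)%N & ~~ (p %| S + a j * Posz t)%Z.
  have [pS|pS] := boolP (p %| S + a j * Posz 1)%Z; last by exists 1%N; rewrite // (ltnW p2).
  exists 2%N; rewrite // [_ + _](_ : _ = (S + a j * Posz 1) + a j); last by ring.
  by rewrite rpredDl.
exists (fun l => if l == i then - w * (S + a j * Posz t) else if l == j then Posz t else 1).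
split=> [l|].
  have [_|_] := eqVneq l i; last by have [_|_] := eqVneq l j; apply: p_small; rewrite // (ltnW p2).
  apply/negP => /(dvdz_nat_prime p_pr); rewrite rpredN => -[].
    exact/negP.
  exact/negP.
rewrite (bigD1 i) //= eqxx (bigD1 j) 1?eq_sym //=; rewrite eqxx (negPf ij).
rewrite (eq_bigr a) -/S; last by move=> l /andP[/negPf-> /negPf->]; rewrite mul1r.
have -> : - w * (S + a j * Posz t) * a i + (Posz t * a j + S) =
  - ((w * a i - 1) * (S + a j * Posz t)) by ring.
by rewrite rpredN dvdz_mulr.
Qed.

(** * The stabiliser of the k-free elements *)

Section Stabiliser.
Variables (K : splittingFieldType rat) (alpha : ringInt K).
Hypothesis alpha_gen : forall s : gal_of {:K}, galO s alpha = alpha -> s = 1%g.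
Hypothesis alpha_unit : `|normO alpha|%N = 1%N.
Local Notation O := (ringInt K).
Variables (k : nat) (A : O -> O).
Hypotheses (k2 : (2 <= k)%N) (A_bij : Zlinear_bij A).
Hypothesis A_kfree : A @` (@kfree _ k) `<=` @kfree _ k.

Let AD : {morph A : x y / x + y} := A_bij.1.

Lemma Zlinear0 : A 0 = 0.
Proof. by apply: (addrI (A 0)); rewrite -AD !addr0. Qed.
Lemma ZlinearN x : A (- x) = - A x.
Proof. by apply: (addrI (A x)); rewrite -AD !subrr Zlinear0. Qed.
Lemma Zlinear_nat (n : nat) x : A (n%:R * x) = n%:R * A x.
Proof.
elim: n => [|n IHn]; first by rewrite !mul0r Zlinear0.
by rewrite -natr1 !mulrDl !mul1r AD IHn.
Qed.
Lemma Zlinear_int (n : int) x : A (n%:~R * x) = n%:~R * A x.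
Proof.
case: n => n; first exact: Zlinear_nat.
by rewrite NegzE mulrNz !mulNr ZlinearN Zlinear_nat.
Qed.
Lemma Zlinear_sum (I : finType) (v : I -> int) (F : I -> O) :
  A (\sum_i (v i)%:~R * F i) = \sum_i (v i)%:~R * A (F i).
Proof.
rewrite (big_morph A AD Zlinear0).
by apply: eq_bigr => i _; rewrite Zlinear_int.
Qed.
Lemma Zlinear_divides (q : nat) x y : divides q%:R (x - y) -> divides q%:R (A x - A y).
Proof.
by case=> z xy; exists (A z); rewrite -ZlinearN -AD xy Zlinear_nat.
Qed.

(** The [a t] are the coefficients, on the idempotents t(e), of the form giving the e-coordinate of
    A x. Only [a i] survives mod p, and s = i^-1 because the coordinate of x at i(e) is the
    e-coordinate of i^-1(x). *)
Lemma stab_mod_split (p : nat) e : prime p -> (2 < p)%N ->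
    split_idempotent (p ^ k) e ->
  exists s : gal_of {:K}, forall x, divides p%:R ((A x - A 1 * galO s x) * e).
Proof.
move=> p_pr p2 eP; have k0 : (0 < k)%N by apply: ltnW.
set q := (p ^ k)%N in eP *; have pq : (p %| q)%N by rewrite dvdn_exp.
have qp x : divides q%:R x -> divides (p%:R : O) x.
  by apply: divides_trans; apply: divides_nat.
have eP1 := split_idempotentW pq eP.
have [e_sum e_orth e_int] := eP.
have ee := split_idempotentK eP.
have /choice[a aP] : forall t, exists c : int,
    divides q%:R (A (galO t e) * e - c%:~R * e) by move=> t; apply: e_int.
have Acomb (v : gal_of {:K} -> int) :
    divides q%:R (A (\sum_t (v t)%:~R * galO t e) * e - (\sum_t v t * a t)%:~R * e).
  rewrite Zlinear_sum rmorph_sum !mulr_suml -sumrB; apply: divides_sum => t _.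
  by rewrite rmorphM -!mulrA -mulrBr; apply: dividesMl.
have coord x : exists c : gal_of {:K} -> int,
    (forall t, divides q%:R (galO t^-1%g x * e - (c t)%:~R * e)) /\
    divides q%:R (x - \sum_t (c t)%:~R * galO t e).
  have /choice[c cP] : forall t, exists c : int,
    divides q%:R (galO t^-1%g x * e - c%:~R * e) by move=> t; apply: e_int.
  exists c; split=> //.
  have -> : x - \sum_t (c t)%:~R * galO t e =
      \sum_t (galO t (galO t^-1%g x * e - (c t)%:~R * e)) - x * (\sum_t galO t e - 1).
    rewrite mulrBr mulr1 mulr_sumr opprB addrCA -sumrB; congr (_ + _).
    rewrite -sumrN; apply: eq_bigr => t _.
    by rewrite rmorphB !rmorphM rmorph_int /= galOKV; ring.
  apply: dividesB; last exact: dividesMl.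
  by apply: divides_sum => t _; apply: divides_galO.
have Acoord x (c : gal_of {:K} -> int) :
    divides q%:R (x - \sum_t (c t)%:~R * galO t e) ->
    divides q%:R (A x * e - (\sum_t c t * a t)%:~R * e).
  move/Zlinear_divides => xc; set y := \sum_t _ in xc.
  have -> : A x * e - (\sum_t c t * a t)%:~R * e =
    e * (A x - A y) + (A y * e - (\sum_t c t * a t)%:~R * e) by ring.
  by apply: dividesD; [apply: dividesMl | apply: Acomb].
have e_neq0 : ~ divides p%:R e.
  rewrite -[e]mul1r => /(split_idempotent_int (c := 1) eP1).
  by rewrite dvdzE absz_nat dvdn1 => /eqP p1; rewrite p1 in p_pr.
(* A is onto: the form takes the value 1 at the preimage of 1. *)
have [i pi] : exists i, ~~ (p %| a i)%Z.
  apply: contrapT => /forallNP pa.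
  have [B _ BK] := A_bij.2; have [c [_ /Acoord]] := coord (B 1).
  rewrite BK mul1r => /qp ec; apply: e_neq0; apply: divides_congr ec _.
  apply/divides_mulr/divides_intr/rpred_sum => t _; apply: dvdz_mull.
  by apply/negPn/negP/pa.
(* Otherwise some y with all coordinates prime to p has A y of e-coordinate 0 mod p^k, and a k-free
   element congruent to y is sent to one that is not k-free. *)
have uniq_i j : j != i -> (p %| a j)%Z.
  move=> ji; apply/negPn/negP => pj; rewrite eq_sym in ji.
  have [v [pv va]] := linear_form_zero p_pr p2 k0 ji pi pj.
  pose y := \sum_t (v t)%:~R * galO t e.
  have yQ (Q : set O) : is_prime_ideal Q -> Q p%:R -> ~ Q y.
    move=> Qp Qpp Qy; have [Qi Q1 QM] := Qp.
    (* The t(e) sum to 1 modulo Q, so one of them is outside Q; multiplying y by it isolates the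
       coordinate [v t]. *)
    have [t nQt] : exists t, ~ Q (galO t e).
      apply: contrapT => /forallNP Qe; apply: Q1.
      rewrite -[1](subKr (\sum_t galO t e)); apply: idealB => //.
        by apply: ideal_sum => // t _; apply: contrapT (Qe t).
      by apply: (ideal_divides Qi Qpp); apply: qp.
    apply: (negP (pv t)); apply: (prime_ideal_int Qp) => //.
    suff : Q ((v t)%:~R * galO t e) by case/QM.
    have Qq x : divides q%:R x -> Q x by move/qp; apply: ideal_divides.
    rewrite -[X in Q X](subKr (y * galO t e)); apply: (idealB Qi); first exact: ideal_mulr.
    apply: Qq; rewrite /y (bigD1 t) //= mulrDl.
    rewrite (_ : _ - _ = (v t)%:~R * galO t (e * e - e) +
      (\sum_(l | l != t) (v l)%:~R * galO l e) * galO t e); last first.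
      by rewrite rmorphB rmorphM; ring.
    apply: dividesD; first exact/dividesMl/divides_galO.
    rewrite mulr_suml; apply: divides_sum => l lt; rewrite -mulrA; apply: dividesMl.
    exact: split_idempotent_galO eP lt.
  have [z yz] := kfree_in_class alpha_gen p_pr k2 yQ.
  have Akf : kfree k (A (y + q%:R * z)) by apply: A_kfree; exists (y + q%:R * z).
  apply: (split_not_kfree p_pr k0 eP _ Akf).
  apply: (divides_congr (Acoord _ v _)).
    by rewrite -/y addrC addKr; apply: dividesMr.
  by apply/divides_mulr/divides_intr.
have sum_ai (c : gal_of {:K} -> int) : (p %| \sum_t c t * a t - c i * a i)%Z.
  have -> : \sum_t c t * a t - c i * a i = \sum_(t | t != i) c t * a t.
    by rewrite (bigD1 i) //=; ring.
  apply: rpred_sum => t /uniq_i.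
  exact: dvdz_mull.
have red x (c : gal_of {:K} -> int) :
    divides q%:R (x - \sum_t (c t)%:~R * galO t e) ->
    divides p%:R (A x * e - (c i * a i)%:~R * e).
  move/Acoord/qp => xc.
  have -> : A x * e - (c i * a i)%:~R * e =
    (A x * e - (\sum_t c t * a t)%:~R * e) + (\sum_t c t * a t - c i * a i)%:~R * e.
    by rewrite intrB; ring.
  by apply: dividesD => //; apply/divides_mulr/divides_intr.
have A1 : divides p%:R (A 1 * e - (a i)%:~R * e).
  rewrite -[a i]mul1r; apply: (red 1 (fun=> 1)).
  by under eq_bigr do rewrite mul1r; apply: dividesB_sym.
exists i^-1%g => x; have [c [ci /red xc]] := coord x.
have -> : (A x - A 1 * galO i^-1%g x) * e = (A x * e - (c i * a i)%:~R * e) -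
    galO i^-1%g x * (A 1 * e - (a i)%:~R * e) -
    (a i)%:~R * (galO i^-1%g x * e - (c i)%:~R * e) by rewrite intrM; ring.
by apply: dividesB; [apply: dividesB => // |]; apply: dividesMl => //; apply: qp.
Qed.

(** With one counterexample [x s] for each of the finitely many s, a single split prime larger than
    the norms of all A(x s) - A 1 * s(x s) contradicts [stab_mod_split]. *)
Lemma stab_is_semilinear : exists s : gal_of {:K}, forall x, A x = A 1 * galO s x.
Proof.
apply: contrapT => /forallNP nA.
have /choice[x xP] : forall s : gal_of {:K}, exists x, A x <> A 1 * galO s x.
  by move=> s; apply/existsNP/nA.
pose N s := absz (normO (A (x s) - A 1 * galO s (x s))).
(* The summands make p odd, unramified, and too large to divide any [N s]. *)
pose b := (2 + `|normO (different alpha)| + \sum_s N s)%N.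
have [p [m [p_pr bp pm]]] := infinitely_many_split_primes b alpha_unit.
have p_big c : (0 < c <= b)%N -> ~~ (p %| c)%N.
  by case/andP=> c0 cb; rewrite gtnNdvd // (leq_ltn_trans cb).
have p_unram : ~~ (p %| normO (different alpha))%Z.
  rewrite dvdzE absz_nat p_big // absz_gt0 different_neq0 //= /b; lia.
have [e eP] := split_idempotent_prime alpha_gen p_pr p_unram pm.
have [E EP] := split_idempotent_lift p_pr (ltnW k2) eP.
have [|s sP] := stab_mod_split p_pr _ EP; first by rewrite /b in bp; lia.
have EP1 := split_idempotentW (_ : p %| p ^ k)%N EP.
have := split_idempotent_dvd_norm (EP1 (dvdn_exp (ltnW k2) (dvdnn p))) (sP (x s)).
rewrite dvdzE absz_nat; apply/negP/p_big/andP; split.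
  rewrite absz_gt0; apply/eqP => /normO_eq0/eqP.
  by rewrite subr_eq0 => /eqP; apply: xP.
by rewrite -/(N s) /b (bigD1 s) //=; lia.
Qed.

End Stabiliser.

(** * Units and Galois automorphisms preserve k-freeness *)

Section KfreeInvariance.
Variable K : splittingFieldType rat.
Local Notation O := (ringInt K).
Implicit Types (s : gal_of {:K}) (u : unitGroup O) (x : O).

Lemma kfree_mulBy k u x : kfree k x -> kfree k (mulBy u x).
Proof.
have uK : (val u)^-1 * val u = 1 by apply: mulVr; apply: valP.
have uE : principal_ideal (mulBy u x) = principal_ideal x.
  apply/seteqP; split=> _ [a _ <-].
    by exists (a * val u) => //; rewrite -mulrA.
  by exists (a * (val u)^-1) => //; rewrite /mulBy -mulrA (mulrA _^-1) uK mul1r.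
case=> x0 nP; split; last by rewrite uE.
by move=> ux0; apply: x0; rewrite -[x]mul1r -uK -mulrA -/(mulBy u x) ux0 mulr0.
Qed.

Definition galO_pre s (I : set O) : set O := [set x | I (galO s x)].

Lemma galO_pre_idealM s I J :
  galO_pre s (idealM I J) = idealM (galO_pre s I) (galO_pre s J).
Proof.
apply/seteqP; split=> x.
  case=> r rP xE; exists [seq (galO s^-1%g p.1, galO s^-1%g p.2) | p <- r].
    by move=> _ /mapP[p /rP[Ip Jp] ->]; rewrite /galO_pre /= !galOKV.
  rewrite -[x](galOK s) xE rmorph_sum big_map; apply: eq_bigr => p _.
  by rewrite rmorphM.
case=> r rP ->; exists [seq (galO s p.1, galO s p.2) | p <- r].
  by move=> _ /mapP[p /rP[Ip Jp] ->].
by rewrite rmorph_sum big_map; apply: eq_bigr => p _; rewrite rmorphM.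
Qed.

Lemma galO_pre_idealX s I k : galO_pre s (idealX I k) = idealX (galO_pre s I) k.
Proof. by elim: k => [//|k IHk]; rewrite [LHS]galO_pre_idealM IHk. Qed.

Lemma galO_pre_ideal s I : is_ideal I -> is_ideal (galO_pre s I).
Proof.
move=> [I0 II]; split; rewrite /galO_pre /= ?rmorph0 // => a x y Ix Iy.
by rewrite rmorphD rmorphM; apply: II.
Qed.

(** Pulling ideals back along s turns a factor P^k of (s x) into a factor (s^-1 P)^k of (x). *)
Lemma kfree_galO s k x : kfree k x -> kfree k (galO s x).
Proof.
case=> x0 nP; split=> [sx0|P [Pi P1 PM] P0 [C Ci sxE]].
  by apply: x0; apply: (@galO_inj _ s); rewrite sx0 rmorph0.
apply: (nP (galO_pre s P)).
- split; first exact: galO_pre_ideal.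
    by rewrite /galO_pre /= rmorph1.
  by move=> y z; rewrite /galO_pre /= rmorphM => /PM.
- move=> sP0; apply: P0; apply/seteqP; split=> y.
    move=> Py; have : galO_pre s P (galO s^-1%g y) by rewrite /galO_pre /= galOKV.
    by rewrite sP0 /= => y0; rewrite -[y](galOKV s) y0 rmorph0.
  by move=> ->; apply: ideal0.
exists (galO_pre s C); first exact: galO_pre_ideal.
rewrite -galO_pre_idealX -galO_pre_idealM -sxE.
apply/seteqP; split=> y.
  by case=> a _ <-; exists (galO s a); rewrite // rmorphM.
case=> a _ ayE; exists (galO s^-1%g a) => //.
by apply: (@galO_inj _ s); rewrite rmorphM /= galOKV.
Qed.

Lemma unitGal_fun_bij (g : unitGal K) : Zlinear_bij (unitGal_fun g).
Proof.
case: g => u s; rewrite /unitGal_fun /=; split=> [x y|].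
  by rewrite /= /mulBy rmorphD mulrDr.
exists (fun x => galO s^-1%g ((val u)^-1 * x)) => x /=.
  by rewrite /mulBy mulKr ?galOK //; apply: valP.
by rewrite /mulBy galOKV mulVKr //; apply: valP.
Qed.

Lemma unitGal_funM (g h : unitGal K) :
  unitGal_fun (g * h)%g = unitGal_fun g \o unitGal_fun h.
Proof.
case: g h => [u s] [v t]; apply/funext => x.
by rewrite /unitGal_fun /= /mulBy galO_comp rmorphM /= mulrA.
Qed.

Lemma unitGal_fun1 : unitGal_fun (1%g : unitGal K) = id.
Proof. by apply/funext => x; rewrite /unitGal_fun /= /mulBy galO_id mul1r. Qed.

Lemma unitGal_fun_stab k (g : unitGal K) : stab (@kfree O k) (unitGal_fun g).
Proof.
split; first exact: unitGal_fun_bij.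
by move=> _ [x kx <-]; apply/kfree_mulBy/kfree_galO.
Qed.

End KfreeInvariance.

(** * Automorphisms of K, and the structure of the stabiliser *)

Lemma image_gal_AutQ (K : splittingFieldType rat) :
  [set (s : K -> K) | s in [set` 'Gal({:K} / 1)%g]] = AutQ K.
Proof.
apply/seteqP; split=> [_ [s _ <-]|f [_ f1 fD fM fZ]].
  split.
  - exists s^-1%g => x; rewrite -galM ?memvf // (mulgV, mulVg) gal_id //.
  - exact: rmorph1.
  - exact: rmorphD.
  - exact: rmorphM.
  - by move=> a x; rewrite linearZ.
have f_lin : linear f by move=> a x y; rewrite fD fZ.
pose g : {linear K -> K} := HB.pack f (GRing.isLinear.Build rat K K *:%R f f_lin).
have gE x : linfun g x = f x by rewrite lfunE.
have : kHom 1 {:K} (linfun g).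
  by apply/kHom_monoid_morphism; split=> [|x y]; rewrite !gE.
rewrite -kAutfE => /kAut_to_gal[s sG sE]; exists s => //.
by apply/funext => x; rewrite -gE sE ?memvf.
Qed.

(** The field fixed by s contains xi, hence is all of K. *)
Lemma generator_fixed (K : splittingFieldType rat) (xi : K) (s : gal_of {:K}) :
  <<1; xi>>%VS = {:K}%VS -> s xi = xi -> s = 1%g.
Proof.
move=> xi_gen sxi; apply/eqP/gal_eqP => x _; rewrite gal_id.
have : (<<1; xi>> <= fixedField [set s]%SET)%VS.
  apply/FadjoinP; split; first exact: sub1v.
  by apply/fixedFieldP; rewrite ?memvf // => t; rewrite finset.in_set1 => /eqP->.
rewrite xi_gen => /subvP/(_ x (memvf x))/fixedFieldP.
by rewrite memvf => /(_ isT); apply; rewrite finset.in_set1.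
Qed.

Theorem theorem5p9 (n : nat) (K : splittingFieldType rat) (xi : K) (k : nat)
    (n_gt2 : (2 < n)%N) (n_mod4 : (n %% 4 != 2)%N)
    (xi_prim : n.-primitive_root xi) (xi_gen : <<1; xi>>%VS = {:K}%VS)
    (k_ge2 : (2 <= k)%N) :
  let V : set (ringInt K) := kfree k in
  [/\ forall A : ringInt K -> ringInt K,
        Zlinear_bij A -> A @` V `<=` V ->
        exists (u : unitGroup (ringInt K)) (s : gal_of {:K}),
          s \in 'Gal({:K} / 1)%g /\ A = mulBy u \o galO s,
      forall A : ringInt K -> ringInt K, stab V A ->
        exists2 B, stab V B & cancel A B /\ cancel B A,
      [/\ stab V = range (@unitGal_fun K),
          injective (@unitGal_fun K),
          @unitGal_fun K 1%g = id
        & forall g h : unitGal K,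
            unitGal_fun (g * h)%g = unitGal_fun g \o unitGal_fun h]
    & [set (s : K -> K) | s in [set` 'Gal({:K} / 1)%g]] = AutQ K].
Proof.
move=> V.
have n0 : (0 < n)%N by apply: leq_trans n_gt2.
have xin : xi ^+ n = 1 by apply: prim_expr_order.
have xi_int : xi \in @integralb K.
  apply/asboolP; exists ('X^n - 1); first exact: monicXnsubC.
  by rewrite rmorphB /= map_polyXn rmorph1 rootE !hornerE xin subrr.
pose alpha := RingInt xi_int.
have alpha_gen (s : gal_of {:K}) : galO s alpha = alpha -> s = 1%g.
  by move=> /(congr1 val); apply: generator_fixed.
have alpha_unit : `|normO alpha|%N = 1%N.
  have : alpha * alpha ^+ n.-1 = 1.
    by rewrite -exprS prednK //; apply: val_inj; rewrite rmorphXn rmorph1.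
  move/(congr1 (fun x => absz (normO x))).
  rewrite normOM abszM -[X in _ = absz (normO X)]/(1%:~R) normO_int expr1n => /eqP.
  by rewrite muln_eq1 => /andP[/eqP].
have main (A : ringInt K -> ringInt K) : Zlinear_bij A -> A @` V `<=` V ->
    exists (u : unitGroup (ringInt K)) (s : gal_of {:K}), A = mulBy u \o galO s.
  move=> A_bij AV.
  have [s As] := stab_is_semilinear alpha_gen alpha_unit k_ge2 A_bij AV.
  have [B _ BK] := A_bij.2.
  (* A is onto: 1 = A (B 1) = A 1 * s(B 1). *)
  have A1U : A 1 \is a GRing.unit.
    by apply/unitrPr; exists (galO s (B 1)); rewrite -As BK.
  by exists (UnitGroup A1U), s; apply/funext => x; apply: As.
have stabE A : stab V A -> exists g, A = unitGal_fun g.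
  by case=> /main/[apply] -[u [s ->]]; exists (UnitGal u s).
split.
- move=> A A_bij /(main A A_bij)[u [s ->]]; exists u, s; split=> //.
  exact: gal_of_mem.
- move=> _ /stabE[g ->]; exists (unitGal_fun g^-1%g); first exact: unitGal_fun_stab.
  by split=> x; rewrite -[LHS]/((_ \o _) x) -unitGal_funM ?mulVg ?mulgV unitGal_fun1.
- split.
  + apply/seteqP; split=> [A /stabE[g ->]|_ [g _ <-]]; first by exists g.
    exact: unitGal_fun_stab.
  (* The value at 1 recovers the unit, and the value at alpha the automorphism. *)
  + move=> [u s] [v t] gh.
    have uv : u = v.
      apply: val_inj; have := congr1 (fun f => f 1) gh.
      by rewrite /unitGal_fun /= /mulBy !rmorph1 !mulr1.
    rewrite uv in gh *; congr (UnitGal _ _).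
    have : galO s alpha = galO t alpha.
      have := congr1 (fun f => f alpha) gh; rewrite /unitGal_fun /= /mulBy.
      by apply: mulrI; apply: valP.
    exact: galO_alpha_inj.
  + exact: unitGal_fun1.
  + exact: unitGal_funM.
- exact: image_gal_AutQ.
Qed.
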